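(* The families $(U_v)_{v\in\mathbb N^n}$ and $(\widehat U_v)_{v\in\mathbb N^n}$ are two adjoint bases of $\mathrm{Pol}$ with respect to $(\,,\,)_q$; more precisely, for all $u,v\in\mathbb N^n$, $$(U_v,\widehat U_{u\omega})_q=\delta_{v,u},$$ where $u\omega=(u_n,\ldots,u_1)$.
   Context: Let $n\ge1$, $q$ an indeterminate, $\mathrm{Pol}=\mathbb{Q}(q)[x_1,\ldots,x_n]$, $x^v=x_1^{v_1}\cdots x_n^{v_n}$; $v$ is dominant if $v_1\ge\cdots\ge v_n$. Operators act on the right, $f\mapsto fD$, and $D_1D_2$ means $D_1$ first. For $1\le i\le n-1$: $f^{s_i}$ is $f$ with $x_i,x_{i+1}$ exchanged, $f\partial_i=(f-f^{s_i})/(x_i-x_{i+1})$, $f\square_i=((x_i-qx_{i+1})f)\partial_i$, $\nabla_i=\square_i-(1+q)$ (so $f\nabla_i=(f\partial_i)(x_{i+1}-qx_i)$). $[k]_q=(1-q^k)/(1-q)$. Permutations in one-line notation $\sigma_1\ldots\sigma_n$; $\sigma s_i$ exchanges $\sigma_i,\sigma_{i+1}$; $\ell$ = length; $\omega=n\cdots21$. Yang–Baxter operators: $Y_{\mathrm{id}}=\widehat Y_{\mathrm{id}}=\mathrm{id}$ and, whenever $\ell(\sigma s_i)>\ell(\sigma)$, with $k=\sigma_{i+1}-\sigma_i$: $Y_{\sigma s_i}=Y_\sigma(\square_i-q[k-1]_q/[k]_q)$ and $\widehat Y_{\sigma s_i}=\widehat Y_\sigma(\nabla_i+q[k-1]_q/[k]_q)$.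 For $w\in\mathbb Z^n$, $\sigma\in\mathfrak S_n$: $w\sigma=(w_{\sigma_1},\ldots,w_{\sigma_n})$. For dominant $\lambda$, $m_j=\#\{i:\lambda_i=j\}$, $d_\lambda(q)=\prod_{j\ge0}\prod_{r=1}^{m_j}[r]_q$. For $v\in\mathbb N^n$ with dominant reordering $\lambda$, $\zeta(v)$ (resp. $\eta(v)$) is the permutation of maximal (resp. minimal) length with $\lambda\zeta(v)=v$ (resp. $\lambda\eta(v)=v$); $U_v=(x^\lambda/d_\lambda(q))Y_{\zeta(v)}$ and $\widehat U_v=x^\lambda\widehat Y_{\eta(v)}$. Scalar product: $g^\clubsuit$ is the image of $g$ under $x_i\mapsto1/x_{n+1-i}$, and $(f,g)_q=CT_{x_n}\bigl(\cdots CT_{x_1}\bigl(f\,g^\clubsuit\prod_{1\le i<j\le n}\frac{1-x_i/x_j}{1-qx_i/x_j}\bigr)\cdots\bigr)$, each $(1-qx_i/x_j)^{-1}$ expanded as $\sum_{k\ge0}q^k(x_i/x_j)^k$, $CT_x$ taking the coefficient of $x^0$. *)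

(* Defs.v *)
From HB Require Import structures.
From mathcomp Require Import all_boot all_order all_fingroup all_algebra.
From mathcomp Require Import boolp classical_sets fsbigop.
From mathcomp Require Import mpoly.

Set Implicit Arguments.
Unset Strict Implicit.
Unset Printing Implicit Defensive.

Import GRing.Theory.

Local Open Scope ring_scope.

Definition Qq : fieldType := {fraction {poly rat}}.
Definition q : Qq := tofrac ('X : {poly rat}).

Definition qint (k : nat) : Qq := (1 - q ^+ k) / (1 - q).

Section Operators.
Variable n : nat.

Local Notation Pol := {mpoly Qq[n]}.

(* Indices are shifted to start at 0: the simple transposition s_i exchanges  *)
(* the positions lpos i = i and rpos i = i + 1, for i : 'I_n.-1.              *)
Definition lpos (i : 'I_n.-1) : 'I_n := widen_ord (leq_pred n) i.

Lemma rpos_subproof (i : 'I_n.-1) : (i.+1 < n)%N.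
Proof. by rewrite -ltn_predRL. Qed.

Definition rpos (i : 'I_n.-1) : 'I_n := Ordinal (rpos_subproof i).

Definition stransp (i : 'I_n.-1) : 'S_n := tperm (lpos i) (rpos i).

(* Operators are written on the right in the usual presentation: f D1 D2,     *)
(* with D1 applied first, is D2 (D1 f) here.                                  *)
Definition ddiff (i : 'I_n.-1) (f : Pol) : Pol :=
  xget 0 [set g : Pol |
    g * ('X_(lpos i) - 'X_(rpos i)) = f - msym (stransp i) f].

Lemma ddiff_ex (i : 'I_n.-1) (f : Pol) : exists g : Pol,
  g * ('X_(lpos i) - 'X_(rpos i)) = f - msym (stransp i) f.
Proof.
pose P (f : Pol) := exists g : Pol,
  g * ('X_(lpos i) - 'X_(rpos i)) = f - msym (stransp i) f.
have P1 : P 1 by exists 0; rewrite mul0r msym1 subrr.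
have PM f1 f2 : P f1 -> P f2 -> P (f1 * f2).
  move=> [g1 e1] [g2 e2]; exists (g1 * f2 + msym (stransp i) f1 * g2).
  rewrite mulrDl -mulrA [f2 * _]mulrC mulrA e1 -mulrA e2 msymM.
  by rewrite mulrBl mulrBr addrA subrK.
have PX k : P 'X_k.
  have sX : msym (stransp i) 'X_k = 'X_(stransp i k) :> Pol.
    rewrite msymX; congr 'X_[_]; apply/mnmP => l; rewrite !mnmE.
    by rewrite /stransp tpermV (can2_eq (tpermK _ _) (tpermK _ _)).
  rewrite /P sX /stransp; case: tpermP => [->|->|_ _].
  - by exists 1; rewrite mul1r.
  - by exists (-1); rewrite mulN1r opprB.
  - by exists 0; rewrite mul0r subrr.
rewrite -/(P f) [f]mpolyE; elim/big_ind: _ => [|f1 f2 [g1 e1] [g2 e2]|m _].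
- by exists 0; rewrite mul0r msym0 subrr.
- by exists (g1 + g2); rewrite mulrDl e1 e2 msymD opprD addrACA.
have [g e] : P 'X_[m].
  rewrite mpolyXE_id; apply: (big_ind P) => [||k _]; [exact: P1|exact: PM|].
  elim: (m k) => [|d IHd]; first by rewrite expr0; exact: P1.
  by rewrite exprS; exact: PM (PX k) IHd.
by exists (f@_m *: g); rewrite -scalerAl e msymZ scalerBr.
Qed.

Lemma ddiffP (i : 'I_n.-1) (f : Pol) :
  ddiff i f * ('X_(lpos i) - 'X_(rpos i)) = f - msym (stransp i) f.
Proof. exact: (xgetPex 0 (ddiff_ex i f)). Qed.

Definition square (i : 'I_n.-1) (f : Pol) : Pol :=
  ddiff i (('X_(lpos i) - q *: 'X_(rpos i)) * f).

Definition nabla (i : 'I_n.-1) (f : Pol) : Pol := square i f - (1 + q) *: f.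

(* A permutation s is its one-line notation s 0, s 1, ..., and its length is  *)
(* its number of inversions.                                                  *)
Definition plength (s : 'S_n) : nat :=
  #|[set p : 'I_n * 'I_n | (p.1 < p.2)%N && (s p.2 < s p.1)%N]|.

(* (s * t) x = t (s x) in MathComp, so stransp i * s is the one-line notation *)
(* of s with its entries at positions lpos i and rpos i exchanged.            *)
(* D i k is the factor attached to s_i and to the gap k = s (i+1) - s i,      *)
(* which is positive whenever the length increases.                           *)
Definition yang_baxter_family (D : 'I_n.-1 -> nat -> Pol -> Pol)
    (Y : 'S_n -> Pol -> Pol) : Prop :=
  (forall f, Y 1%g f = f) /\
  (forall (s : 'S_n) (i : 'I_n.-1),
     (plength s < plength (stransp i * s)%g)%N ->
     forall f, Y (stransp i * s)%g f = D i (s (rpos i) - s (lpos i))%N (Y s f)).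

(* By the Yang-Baxter relations there is exactly one such family for each of  *)
(* the two choices of D used below; the default of [xget] is irrelevant.      *)
Definition yang_baxter (D : 'I_n.-1 -> nat -> Pol -> Pol) : 'S_n -> Pol -> Pol :=
  xget (fun _ f => f : Pol) [set Y : 'S_n -> Pol -> Pol | yang_baxter_family D Y].

Definition Y : 'S_n -> Pol -> Pol :=
  yang_baxter (fun i k f => square i f - (q * qint k.-1 / qint k) *: f).

Definition Yhat : 'S_n -> Pol -> Pol :=
  yang_baxter (fun i k f => nabla i f + (q * qint k.-1 / qint k) *: f).

Definition mact (w : 'X_{1..n}) (s : 'S_n) : 'X_{1..n} :=
  [multinom w (s i) | i < n].

Definition mrev (w : 'X_{1..n}) : 'X_{1..n} := [multinom w (rev_ord i) | i < n].

Definition dom (v : 'X_{1..n}) : 'X_{1..n} :=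
  [multinom nth 0%N (sort geq [seq v j | j <- enum 'I_n]) i | i < n].

Definition mult (lam : 'X_{1..n}) (j : nat) : nat :=
  #|[set i : 'I_n | lam i == j]|.

(* Every part of lam is at most mdeg lam; larger j contribute the factor 1.   *)
Definition dcoef (lam : 'X_{1..n}) : Qq :=
  \prod_(0 <= j < (mdeg lam).+1) \prod_(1 <= r < (mult lam j).+1) qint r.

(* The value 1%g below is only a syntactic default: some permutation always   *)
(* satisfies the constraint, and the extremal one is unique.                  *)
Definition zeta (v : 'X_{1..n}) : 'S_n :=
  [arg max_(s > 1%g | mact (dom v) s == v) plength s]%N.

Definition eta (v : 'X_{1..n}) : 'S_n :=
  [arg min_(s < 1%g | mact (dom v) s == v) plength s]%N.

Definition U (v : 'X_{1..n}) : Pol :=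
  Y (zeta v) ((dcoef (dom v))^-1 *: 'X_[dom v]).

Definition Uhat (v : 'X_{1..n}) : Pol := Yhat (eta v) 'X_[dom v].

Definition is_basis (b : 'X_{1..n} -> Pol) : Prop :=
  (forall (s : seq 'X_{1..n}) (c : 'X_{1..n} -> Qq), uniq s ->
     \sum_(v <- s) c v *: b v = 0 -> forall v, v \in s -> c v = 0) /\
  (forall f : Pol, exists (s : seq 'X_{1..n}) (c : 'X_{1..n} -> Qq),
     f = \sum_(v <- s) c v *: b v).

End Operators.

Section ScalarProduct.
Variable n : nat.

Local Notation Pol := {mpoly Qq[n]}.

(* Formal series in x_0^{±1}, ..., x_(n-1)^{±1}, as coefficient functions on  *)
(* exponents.                                                                 *)
Definition expo := {ffun 'I_n -> int}.
Definition series := expo -> Qq.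

Definition smon (a : expo) : series := fun e => (e == a)%:R.

(* The Cauchy product; it is meaningful when each coefficient is a finite     *)
(* sum, as for series supported in finitely many translates of the cone       *)
(* spanned by the exponents of the x_i / x_j, i < j.                          *)
Definition smul (A B : series) : series :=
  fun e => \sum_(d \in [set: expo]) A d * B (e - d).

Definition spoly (f : Pol) : series :=
  fun e => \sum_(a <- msupp f) f@_a * smon [ffun i => (a i)%:Z] e.

(* The image of g under x_i |-> 1 / x_(n-1-i). *)
Definition sclub (g : Pol) : series :=
  fun e => \sum_(a <- msupp g) g@_a * smon [ffun i => - (a (rev_ord i))%:Z] e.

(* The exponent of x_i / x_j. *)
Definition ratio (i j : 'I_n) : expo :=
  [ffun l => (l == i)%:Z - (l == j)%:Z].

Definition sgeom (i j : 'I_n) : series :=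
  fun e => \sum_(k \in [set: nat]) q ^+ k * smon (ratio i j *+ k) e.

Definition qkernel : series :=
  \big[smul/smon 0]_(ij : 'I_n * 'I_n | (ij.1 < ij.2)%N)
    smul (fun e => smon 0 e - smon (ratio ij.1 ij.2) e) (sgeom ij.1 ij.2).

(* The coefficient of x_i^0, as a series not involving x_i. *)
Definition CT (A : series) (i : 'I_n) : series :=
  fun e => if e i == 0 then A e else 0.

(* The variable x_0 is treated first; once all of them have been treated only *)
(* the constant coefficient remains.                                          *)
Definition qscalar (f g : Pol) : Qq :=
  foldl CT (smul (smul (spoly f) (sclub g)) qkernel) (enum 'I_n) 0.

End ScalarProduct.

(* Main.v *)
(* Only the recursion of the two families along the simple transpositions      *)
(* matters. For v dominant, U_v and Uhat_v both equal x^v; if v_i > v_(i+1),   *)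
(* then U_(v s_i) = U_v (sq_i - a) and Uhat_(v s_i) = Uhat_v (sq_i - b), with  *)
(* a + b = 1 + q when the gaps agree; if v_i = v_(i+1), then both are          *)
(* eigenvectors of sq_i for 1 + q. As sq_i^2 = (1 + q) sq_i, this gives the    *)
(* matrices of sq_i in both families, and through v |-> v omega they are       *)
(* transposes of each other. Since the adjoint of sq_i is sq_(n-i), the        *)
(* duality propagates along orbits and has to be checked for dominant v only.  *)
(*                                                                             *)
(* There the quadratic form N(v) = sum v_i^2 replaces the dominance order. The *)
(* scalar product (x^a, x^b) is the coefficient K(e), e = b omega - a, of the  *)
(* kernel, which vanishes outside the positive root cone; if a is dominant,    *)
(* e in the cone gives N(b) = N(a) + 2<a, e> + N(e) >= N(a) + N(e), so that    *)
(* N(b) <= N(a) forces e = 0. On the other side sq_i x^u is supported by u,    *)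
(* u s_i and exponents of smaller norm, so Uhat_v has leading term x^v.        *)

Require Import Defs.
From mathcomp Require Import boolp classical_sets fsbigop.
From mathcomp Require Import all_boot all_order all_fingroup all_algebra.
From mathcomp Require Import mpoly zify ring.

Set Implicit Arguments.
Unset Strict Implicit.
Unset Printing Implicit Defensive.

(* Defs comes last: its mact must shadow the action mact of the group library. *)
Import Defs Order.TTheory GRing.Theory Num.Theory.

Local Open Scope ring_scope.

(** * Permutations, exponents and their orbits *)

(** Everything rests on the operators sq_i and their adjoints. With z = x_i/x_(i+1), the kernel is
    (1 - z)/(1 - q z) times a series invariant under s_i. The factor 1 - z clears the denominator of
    sq_i and what remains is symmetric in both arguments, so that sq_i and sq_(n-i) are adjoint
    ([form_adjoint], fed by [kprod'_sym], [kprod'E] and [qkernel_kgeom]).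

    As nabla_i + a = sq_i - (1 + q - a), both Yang-Baxter families have steps of the form sq_i minus
    a scalar depending on the gap. Such families exist because the sq_i satisfy Hecke relations and
    the scalars satisfy [yb_weight] ([ybop_family_ex]). What is used of U and Uhat afterwards is
    collected in [orbit_family] and proved in [Z_zeta_family] and [Z_eta_family]. For U, the
    normalisation d_lambda is exactly the scalar by which Y_(zeta lambda) multiplies x^lambda
    ([Z_young], [zeta_weight]). For Uhat, equal neighbouring parts give an eigenvector because one
    further step kills it ([Z_block_inversion]).

    Duality goes by induction from a dominant v along its orbit, moving sq_i across the form
    ([form_dual_le]). The dominant case [form_dominant] combines the leading term of Uhat
    ([family_lead]) with the support of the kernel. If N(u) > N(v), the pairing vanishes for reasons
    of norm ([form_low]). Duality gives linear independence ([free_U], [free_V]), and triangularity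
    of sq_i on monomials gives generation ([spanned_mono]). *)

Section Combinatorics.
Variable n : nat.
Implicit Types (i : 'I_n.-1) (u v w : 'X_{1..n}) (s : 'S_n) (x y : 'I_n).

Lemma stranspL i : stransp i (lpos i) = rpos i. Proof. exact: tpermL. Qed.
Lemma stranspR i : stransp i (rpos i) = lpos i. Proof. exact: tpermR. Qed.
Lemma stranspK i : involutive (stransp i). Proof. exact: tpermK. Qed.

Lemma stransp_ltn i x y : (x < y)%N -> (x, y) != (lpos i, rpos i) ->
  (stransp i x < stransp i y)%N.
Proof.
rewrite xpair_eqE -!(inj_eq val_inj) /= /stransp.
case: tpermP => [->|->|/eqP + /eqP +]; case: tpermP => [->|->|/eqP + /eqP +];
  rewrite -?(inj_eq val_inj) /= ; lia.
Qed.

Lemma stransp_ltn_eq i x y : (x, y) != (lpos i, rpos i) ->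
  (y, x) != (lpos i, rpos i) -> (stransp i x < stransp i y)%N = (x < y)%N.
Proof.
move=> h1 h2; case: (ltngtP x y) => [h|h|/val_inj ->]; last by rewrite ltnn.
  exact: stransp_ltn.
by apply/negbTE; rewrite -leqNgt ltnW // stransp_ltn.
Qed.

(** s_i permutes the pairs x < y other than (i, i+1), so only that pair changes its contribution.
    Counting inversions, counting ascents and multiplying eigenvalues give [plength_stransp],
    [asc_sw] and the inductive step of [Z_young]. *)
Lemma big_stransp (R : Type) (idx : R) (op : Monoid.com_law idx) (T : Type)
    (G : T -> T -> R) (f : 'I_n -> T) i :
  op (G (f (lpos i)) (f (rpos i)))
    (\big[op/idx]_(p : 'I_n * 'I_n | (p.1 < p.2)%N)
       G (f (stransp i p.1)) (f (stransp i p.2))) =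
  op (G (f (rpos i)) (f (lpos i)))
    (\big[op/idx]_(p : 'I_n * 'I_n | (p.1 < p.2)%N) G (f p.1) (f p.2)).
Proof.
have lr : ((lpos i, rpos i).1 < (lpos i, rpos i).2)%N by rewrite /=.
rewrite (bigD1 (lpos i, rpos i)) // [in RHS](bigD1 (lpos i, rpos i)) //=.
rewrite stranspL stranspR Monoid.mulmCA; congr (op _ (op _ _)).
have tinj : injective (fun p : 'I_n * 'I_n => (stransp i p.1, stransp i p.2)).
  by move=> [a b] [c d] /= [/perm_inj -> /perm_inj ->].
rewrite (reindex_inj tinj) /=; apply: eq_big => [[x y]|[x y] _] /=; last first.
  by rewrite !stranspK.
apply/andP/andP => -[h1 h2]; split.
- have := stransp_ltn h1 h2; rewrite !stranspK; exact.
- apply: contraTneq h1 => -[-> ->]; rewrite stranspL stranspR /=; lia.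
- exact: stransp_ltn.
- apply: contraTneq h1 => -[/(canRL (stranspK i)) -> /(canRL (stranspK i)) ->].
  rewrite stranspL stranspR /=; lia.
Qed.

Lemma plengthE s :
  plength s = (\sum_(p : 'I_n * 'I_n | (p.1 < p.2)%N) (s p.2 < s p.1))%N.
Proof.
rewrite /plength -sum1_card big_mkcond [RHS]big_mkcond /=.
by apply: eq_bigr => p _; rewrite inE; case: (_ < _)%N => //=; case: (_ < _)%N.
Qed.

Lemma plength_stransp i s :
  (plength (stransp i * s)%g + (s (rpos i) < s (lpos i)) =
   plength s + (s (lpos i) < s (rpos i)))%N.
Proof.
rewrite addnC [RHS]addnC !plengthE.
have := @big_stransp nat 0%N addn _ (fun a b : nat => (b < a)%N : nat)
  (fun x => s x) i => /= <-.
by congr addn; apply: eq_bigr => p _; rewrite !permM.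
Qed.

Lemma perm_lr_neq i s : s (lpos i) != s (rpos i).
Proof.
by apply/eqP => /perm_inj /(congr1 (@nat_of_ord n)) /=; lia.
Qed.

Lemma plength_lt i s :
  (plength s < plength (stransp i * s)%g)%N = (s (lpos i) < s (rpos i))%N.
Proof.
have := plength_stransp i s; have := perm_lr_neq i s.
by rewrite -(inj_eq val_inj) /=; case: ltngtP => //; lia.
Qed.

Lemma stransp_mulK i s : (stransp i * (stransp i * s) = s)%g.
Proof. by rewrite mulgA /stransp tperm2 mul1g. Qed.

Lemma plength1 : plength (1 : 'S_n)%g = 0%N.
Proof.
rewrite plengthE big1 // => p h; rewrite !perm1.
by case: ltngtP h.
Qed.

Lemma homo_lrpos (r : rel nat) (f : 'I_n -> nat) : reflexive r -> transitive r ->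
  (forall i, r (f (lpos i)) (f (rpos i))) ->
  forall x y, (x <= y)%N -> r (f x) (f y).
Proof.
move=> rr rt h x y; move: {2}(y - x)%N (erefl (y - x)%N) => d.
elim: d x => [|d IHd] x dE le; first by have /val_inj -> : x = y :> nat by lia.
have xn : (x < n.-1)%N by have := ltn_ord y; lia.
have -> : x = lpos (Ordinal xn) by exact: val_inj.
apply: (rt _ _ _ (h _)); apply: IHd => /=; lia.
Qed.

Lemma perm_rank s x : s x = #|[set y | (s y < s x)%N]| :> nat.
Proof.
have -> : [set y | (s y < s x)%N] = s @^-1: [set z : 'I_n | (z < s x)%N].
  by apply/setP => y; rewrite !inE.
rewrite card_preimset; last exact: perm_inj.
rewrite -sum1_card (eq_bigl (fun z : 'I_n => (z < s x)%N)); last first.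
  by move=> z; rewrite inE.
rewrite -(big_ord_widen n (fun _ => 1%N)) ?sum1_card ?card_ord //.
exact/ltnW/ltn_ord.
Qed.

Lemma perm_order_eq s1 s2 :
  (forall x y, (s1 x < s1 y)%N = (s2 x < s2 y)%N) -> s1 = s2.
Proof.
move=> h; apply/permP => x; apply: val_inj; rewrite /= [LHS]perm_rank [RHS]perm_rank.
by apply: eq_card => y; rewrite !inE h.
Qed.

Lemma perm_incr s :
  (forall i, (s (lpos i) < s (rpos i))%N) -> s = 1%g.
Proof.
move=> h; apply: perm_order_eq => x y; rewrite !perm1.
have m := @homo_lrpos leq (fun x => s x) leqnn leq_trans (fun i => ltnW (h i)).
case: (ltngtP x y) => [xy|yx|/val_inj ->]; last by rewrite ltnn.
- rewrite ltn_neqAle m ?(ltnW xy) // andbT.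
  by apply: contraTneq xy => /val_inj/perm_inj ->; rewrite ltnn.
- by apply/negbTE; rewrite -leqNgt m // ltnW.
Qed.

Lemma perm_descent s : s != 1%g -> exists i, (s (rpos i) < s (lpos i))%N.
Proof.
move=> s1; apply/existsP; apply: contraNT s1; rewrite negb_exists => /forallP h.
apply/eqP/perm_incr => i; have := h i; have := perm_lr_neq i s.
by rewrite -(inj_eq val_inj) /=; lia.
Qed.

(** Send x to the number of its predecessors: transitivity makes this strictly increasing for [r],
    and totality then makes it injective. *)
Lemma ex_rank_perm (r : rel 'I_n) : irreflexive r -> transitive r ->
  (forall x y, x != y -> r x y || r y x) ->
  exists s, forall x y, (s x < s y)%N = r x y.
Proof.
move=> ri rt rtot.
have bound x : (#|[set y | r y x]| < n)%N.
  rewrite -[X in (_ < X)%N]card_ord -cardsT; apply: proper_card.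
  by rewrite properE subsetT; apply/subsetPn; exists x; rewrite ?inE ?ri.
pose f x := Ordinal (bound x).
have fr x y : r x y -> (f x < f y)%N.
  move=> xy; apply: proper_card; rewrite properE; apply/andP; split.
    by apply/subsetP => z; rewrite !inE => zx; apply: rt zx xy.
  by apply/subsetPn; exists x; rewrite !inE ?ri.
have finj : injective f.
  move=> x y e; apply/eqP; apply: contraT => /rtot /orP [] /fr; rewrite e ltnn //.
exists (perm finj) => x y; rewrite !permE.
have [->|/rtot/orP [h|h]] := eqVneq x y; first by rewrite ltnn ri.
  by rewrite fr.
rewrite ltnNge ltnW ?fr //=; apply/esym/negP => h2.
by have := rt _ _ _ h h2; rewrite ri.
Qed.

(** * Dominant exponents and the extremal permutations zeta and eta *)

Definition dominant v := forall x y, (x <= y)%N -> (v y <= v x)%N.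

Lemma mactE v s x : mact v s x = v (s x). Proof. exact: mnmE. Qed.
Lemma mrevE v x : mrev v x = v (rev_ord x). Proof. exact: mnmE. Qed.

Lemma mactM v s1 s2 : mact (mact v s1) s2 = mact v (s2 * s1)%g.
Proof. by apply/mnmP => x; rewrite !mactE permM. Qed.
Lemma mact1 v : mact v 1%g = v.
Proof. by apply/mnmP => x; rewrite !mactE perm1. Qed.

Definition mvals v := [seq v j | j <- enum 'I_n].

Lemma nth_mvals v x : nth 0%N (mvals v) x = v x.
Proof. by rewrite (nth_map x) ?size_enum_ord // nth_ord_enum. Qed.

Lemma size_mvals v : size (mvals v) = n.
Proof. by rewrite size_map size_enum_ord. Qed.

Lemma perm_mvals v s : perm_eq (mvals (mact v s)) (mvals v).
Proof.
rewrite /mvals; have -> : [seq mact v s j | j <- enum 'I_n] =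
   [seq v j | j <- [seq s j | j <- enum 'I_n]].
  by rewrite -[RHS]map_comp; apply: eq_map => x; rewrite /= mactE.
apply: perm_map; apply: uniq_perm; rewrite ?enum_uniq //.
  by rewrite map_inj_uniq ?enum_uniq //; exact: perm_inj.
by move=> x; rewrite mem_enum; apply/mapP; exists (s^-1%g x); rewrite ?mem_enum ?permKV.
Qed.

Lemma geq_total : total geq. Proof. by move=> a b; rewrite /geq /=; lia. Qed.
Lemma geq_trans : transitive geq. Proof. by move=> a b c; rewrite /geq /=; lia. Qed.
Lemma geq_anti : antisymmetric geq. Proof. by move=> a b; rewrite /geq /=; lia. Qed.

Lemma dom_mact v s : dom (mact v s) = dom v.
Proof.
apply/mnmP => x; rewrite !mnmE; congr nth.
by apply/perm_sortP; [exact: geq_total|exact: geq_trans|exact: geq_anti|exact: perm_mvals].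
Qed.

Lemma dom_id v : dominant v -> dom v = v.
Proof.
move=> h; apply/mnmP => x; rewrite !mnmE sorted_sort; last 2 first.
- exact: geq_trans.
- apply/(sortedP 0%N) => k; rewrite -/(mvals v) size_mvals => kn.
  have := nth_mvals v (Ordinal (ltnW kn)); have := nth_mvals v (Ordinal kn) => /= -> ->.
  by apply: (h (Ordinal (ltnW kn))) => /=.
exact: nth_mvals.
Qed.

Lemma dom_dominant v : dominant (dom v).
Proof.
move=> x y xy; rewrite !mnmE.
have := @sorted_leq_nth _ geq geq_trans leqnn 0%N (sort geq (mvals v))
  (sort_sorted geq_total _).
by apply; rewrite ?inE ?size_sort ?size_mvals.
Qed.

(** The order in which [zeta v] numbers the positions: larger parts come first, and equal parts are
    read from right to left, so that any two of them form an inversion. In [eprec] equal parts are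
    read from left to right and form none. *)
Definition zprec v x y := (v y < v x)%N || (v x == v y) && (y < x)%N.
Definition eprec v x y := (v y < v x)%N || (v x == v y) && (x < y)%N.

Lemma mact_rank v s :
  (forall x y, (s x < s y)%N -> (v y <= v x)%N) -> mact (dom v) s = v.
Proof.
move=> h; rewrite -(dom_mact v s^-1%g) dom_id; first by rewrite mactM mulgV mact1.
move=> x y; rewrite !mactE leq_eqVlt => /orP[/eqP/val_inj -> //|xy].
by apply: h; rewrite !permKV.
Qed.

Lemma ex_zperm v : exists s, forall x y, (s x < s y)%N = zprec v x y.
Proof.
apply: ex_rank_perm => [x|y x z|x y]; rewrite /zprec; first by rewrite !ltnn andbF.
  by lia.
by rewrite -(inj_eq val_inj) /=; lia.
Qed.

Lemma ex_eperm v : exists s, forall x y, (s x < s y)%N = eprec v x y.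
Proof.
apply: ex_rank_perm => [x|y x z|x y]; rewrite /eprec; first by rewrite !ltnn andbF.
  by lia.
by rewrite -(inj_eq val_inj) /=; lia.
Qed.

Lemma mact_dom_lt v s x y : mact (dom v) s = v -> (v x < v y)%N -> (s y < s x)%N.
Proof.
move=> e; rewrite -{1 2}e !mactE => h; rewrite ltnNge; apply/negP => h2.
by have := dom_dominant v h2; rewrite leqNgt h.
Qed.

(** The default [i0] may violate [P], as 1 can in [zeta] and [eta]. It is returned only when no
    extremal element is found, and [P j] guarantees that there is one. *)
Lemma extremum_ex (r : rel nat) (T : finType) (i0 : T) (P : pred T) (F : T -> nat) :
  reflexive r -> transitive r -> total r -> (exists j, P j) ->
  extremum_spec r P F (extremum r i0 P F).
Proof.
move=> rr rt rtot /sigW[j Pj]; have := extremumP F rr rt rtot Pj.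
rewrite /extremum; case: pickP => //= noi [i Pi mi].
by have := noi i; rewrite /= Pi /= => /negP[]; apply/'forall_implyP.
Qed.

(** If lambda z = v, distinct parts force the relative order of the values of z, and only pairs of
    equal parts are free. The permutation s of [zprec] inverts all the latter, so every inversion of
    z is one of s, and maximality of z forces z = s. *)
Lemma zeta_spec v : mact (dom v) (zeta v) = v /\
  forall x y, (zeta v x < zeta v y)%N = zprec v x y.
Proof.
have [s sP] := ex_zperm v.
have sv : mact (dom v) s = v by apply: mact_rank => x y; rewrite sP /zprec; lia.
rewrite /zeta /arg_max.
have [] := @extremum_ex geq _ 1%g (fun s => mact (dom v) s == v) (@plength n).
- exact: leqnn.
- exact: geq_trans.
- exact: geq_total.
- by exists s; rewrite sv.
move=> z /eqP zv zmax; split=> //.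
have le (p : 'I_n * 'I_n) : (p.1 < p.2)%N -> ((z p.2 < z p.1)%N <= (s p.2 < s p.1)%N ?=
    iff ((z p.2 < z p.1)%N == (s p.2 < s p.1)%N))%N.
  move=> p12; split; last by do 2 case: (_ < _)%N.
  rewrite sP /zprec; case: (ltnP (z p.2) (z p.1)) => // h.
  by have := @mact_dom_lt v z p.2 p.1 zv; lia.
(* Equality of two sums compared termwise is equality of every term. *)
have [] := leqif_sum le; rewrite -!plengthE => _.
have -> : plength z == plength s.
  rewrite eqn_leq; apply/andP; split; last by apply: zmax; rewrite sv.
  by rewrite !plengthE; apply: leq_sum => p /le [].
move=> /esym/forall_inP h.
have zs x y : (x < y)%N -> (z y < z x)%N = (s y < s x)%N by move=> xy; have /eqP := h (x, y) xy.
suff -> : z = s by [].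
apply: perm_order_eq => x y; case: (ltngtP x y) => [xy|yx|/val_inj ->].
- have xny : x != y by rewrite -(inj_eq val_inj) /= ltn_eqF.
  have := zs _ _ xy; have : z x != z y by rewrite (inj_eq perm_inj).
  have : s x != s y by rewrite (inj_eq perm_inj).
  by rewrite -!(inj_eq val_inj) /=; lia.
- exact: zs.
- by rewrite !ltnn.
Qed.

(** The same comparison with the inequality reversed, as the permutation of [eprec] inverts no pair
    of equal parts. *)
Lemma eta_spec v : mact (dom v) (eta v) = v /\
  forall x y, (eta v x < eta v y)%N = eprec v x y.
Proof.
have [s sP] := ex_eperm v.
have sv : mact (dom v) s = v by apply: mact_rank => x y; rewrite sP /eprec; lia.
rewrite /eta /arg_min.
have [] := @extremum_ex leq _ 1%g (fun s => mact (dom v) s == v) (@plength n).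
- exact: leqnn.
- exact: leq_trans.
- exact: leq_total.
- by exists s; rewrite sv.
move=> z /eqP zv zmin; split=> //.
have le (p : 'I_n * 'I_n) : (p.1 < p.2)%N -> ((s p.2 < s p.1)%N <= (z p.2 < z p.1)%N ?=
    iff ((s p.2 < s p.1)%N == (z p.2 < z p.1)%N))%N.
  move=> p12; split; last by do 2 case: (_ < _)%N.
  rewrite sP /eprec; case: (ltnP (z p.2) (z p.1)) => h; first by case: (_ || _).
  by have := @mact_dom_lt v z p.1 p.2 zv; lia.
have [] := leqif_sum le; rewrite -!plengthE => _.
have -> : plength s == plength z.
  rewrite eqn_leq; apply/andP; split; last by apply: zmin; rewrite sv.
  by rewrite !plengthE; apply: leq_sum => p /le [].
move=> /esym/forall_inP h.
have zs x y : (x < y)%N -> (z y < z x)%N = (s y < s x)%N.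
  by move=> xy; have /eqP/esym := h (x, y) xy.
suff -> : z = s by [].
apply: perm_order_eq => x y; case: (ltngtP x y) => [xy|yx|/val_inj ->].
- have xny : x != y by rewrite -(inj_eq val_inj) /= ltn_eqF.
  have := zs _ _ xy; have : z x != z y by rewrite (inj_eq perm_inj).
  have : s x != s y by rewrite (inj_eq perm_inj).
  by rewrite -!(inj_eq val_inj) /=; lia.
- exact: zs.
- by rewrite !ltnn.
Qed.

Lemma zetaE v : mact (dom v) (zeta v) = v. Proof. by case: (zeta_spec v). Qed.
Lemma etaE v : mact (dom v) (eta v) = v. Proof. by case: (eta_spec v). Qed.
Lemma zeta_lt v x y : (zeta v x < zeta v y)%N = zprec v x y.
Proof. by case: (zeta_spec v). Qed.
Lemma eta_lt v x y : (eta v x < eta v y)%N = eprec v x y.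
Proof. by case: (eta_spec v). Qed.

(** * Exchange of neighbouring parts, reversal, and induction on orbits *)

Definition sw v i := mact v (stransp i).

Lemma swK v i : sw (sw v i) i = v.
Proof. by rewrite /sw mactM /stransp tperm2 mact1. Qed.
Lemma sw_l v i : sw v i (lpos i) = v (rpos i). Proof. by rewrite mactE stranspL. Qed.
Lemma sw_r v i : sw v i (rpos i) = v (lpos i). Proof. by rewrite mactE stranspR. Qed.
Lemma sw_id v i : v (lpos i) = v (rpos i) -> sw v i = v.
Proof.
move=> e; apply/mnmP => x; rewrite mactE /stransp.
by case: tpermP => [->|->|].
Qed.
Lemma dom_sw v i : dom (sw v i) = dom v. Proof. exact: dom_mact. Qed.

(** Since the parts at i and i+1 differ, s_i keeps the order of any two positions with equal parts,
    and with it the tie-breaking rule. *)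
Lemma zeta_sw v i : v (lpos i) != v (rpos i) ->
  zeta (sw v i) = (stransp i * zeta v)%g.
Proof.
move=> ne; apply: perm_order_eq => x y.
rewrite zeta_lt !permM zeta_lt /zprec !mactE.
case: (v (stransp i x) =P v (stransp i y)) => //= e; congr (_ || _).
by rewrite stransp_ltn_eq //; apply: contra_eqN e => /eqP[-> ->];
  rewrite stranspL stranspR // eq_sym.
Qed.

Lemma eta_sw v i : v (lpos i) != v (rpos i) ->
  eta (sw v i) = (stransp i * eta v)%g.
Proof.
move=> ne; apply: perm_order_eq => x y.
rewrite eta_lt !permM eta_lt /eprec !mactE.
case: (v (stransp i x) =P v (stransp i y)) => //= e; congr (_ || _).
by rewrite stransp_ltn_eq //; apply: contra_eqN e => /eqP[-> ->];
  rewrite stranspL stranspR // eq_sym.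
Qed.

Lemma mrevK v : mrev (mrev v) = v.
Proof. by apply/mnmP => x; rewrite !mrevE rev_ordK. Qed.

Lemma mrev_mact v : mrev v = mact v (perm (@rev_ord_inj n)).
Proof. by apply/mnmP => x; rewrite mactE mrevE permE. Qed.

Lemma dom_mrev v : dom (mrev v) = dom v.
Proof. by rewrite mrev_mact dom_mact. Qed.

(** Reversing the positions exchanges the two tie-breaking rules. The gaps of [zeta v] thus reappear
    for [eta] at the reversed exponent, which is what matches the scalars of the two families. *)
Lemma eta_mrev v x : eta (mrev v) (rev_ord x) = zeta v x.
Proof.
have e (a : 'I_n) : eta (mrev v) (rev_ord a) = (perm (@rev_ord_inj n) * eta (mrev v))%g a.
  by rewrite permM permE.
rewrite e; congr (fun_of_perm _ x); apply: perm_order_eq => a b.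
rewrite -!e eta_lt zeta_lt /eprec /zprec !mrevE !rev_ordK /=.
have := ltn_ord a; have := ltn_ord b; lia.
Qed.

Lemma lpos_rev i : lpos (rev_ord i) = rev_ord (rpos i).
Proof. by apply: val_inj => /=; have := ltn_ord i; lia. Qed.
Lemma rpos_rev i : rpos (rev_ord i) = rev_ord (lpos i).
Proof. by apply: val_inj => /=; have := ltn_ord i; lia. Qed.

Lemma stransp_rev i x : stransp (rev_ord i) (rev_ord x) = rev_ord (stransp i x).
Proof.
rewrite /stransp lpos_rev rpos_rev [tperm (rev_ord _) _]tpermC.
exact/esym/(inj_tperm _ _ _ (@rev_ord_inj n)).
Qed.

Lemma mrev_sw v i : mrev (sw v i) = sw (mrev v) (rev_ord i).
Proof.
apply/mnmP => x; rewrite !mrevE !mactE mrevE; congr (v _).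
by rewrite -{2}[x]rev_ordK stransp_rev rev_ordK.
Qed.

(** This is the length of [eta v]: it measures how far v is from the dominant exponent of its
    orbit. *)
Definition asc v := (\sum_(p : 'I_n * 'I_n | (p.1 < p.2)%N) (v p.1 < v p.2))%N.

Lemma asc_sw v i :
  (asc (sw v i) + (v (lpos i) < v (rpos i)) = asc v + (v (rpos i) < v (lpos i)))%N.
Proof.
rewrite addnC [RHS]addnC.
have := @big_stransp nat 0%N addn _ (fun a b : nat => (a < b)%N : nat)
  (fun x => v x) i => /= <-.
by congr addn; apply: eq_bigr => p _; rewrite !mactE.
Qed.

Lemma asc_le v : (asc v <= n * n)%N.
Proof.
rewrite /asc -[in X in (_ <= X)%N](card_ord n) -card_prod -sum1_card big_mkcond.
by apply: leq_sum => p _; do 2 case: (_ < _)%N.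
Qed.

(** A non-dominant exponent has some v_i < v_(i+1), and exchanging these two parts lowers [asc] by
    one. *)
Lemma orbit_ind (P : 'X_{1..n} -> Prop) :
  (forall v, dominant v -> P v) ->
  (forall v i, (v (rpos i) < v (lpos i))%N -> P v -> P (sw v i)) ->
  forall v, P v.
Proof.
move=> Pd Ps v; move: {2}(asc v) (leqnn (asc v)) => d.
elim: d v => [|d IHd] v vd.
all: have [dv|] := boolP [forall i : 'I_n.-1, (v (rpos i) <= v (lpos i))%N];
  [by apply: Pd; exact: (@homo_lrpos geq (fun x => v x) leqnn geq_trans (forallP dv))
  |rewrite negb_forall => /existsP[i]; rewrite -ltnNge => h].
all: have := asc_sw v i.
  lia.
move=> e; rewrite -(swK v i); apply: Ps; first by rewrite sw_l sw_r.
by apply: IHd; lia.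
Qed.

(** Exchanging parts v_i > v_(i+1) raises [asc], which is bounded. The process stops only at the
    antidominant exponent of the orbit. *)
Lemma asc_max v : v = mrev (dom v) \/ (asc v < asc (mrev (dom v)))%N.
Proof.
move: {2}(n * n - asc v)%N (leqnn (n * n - asc v)%N) => d.
elim: d v => [|d IHd] v vd.
all: have [dv|] := boolP [forall i : 'I_n.-1, (v (lpos i) <= v (rpos i))%N];
  [left|rewrite negb_forall => /existsP[i]; rewrite -ltnNge => h].
1,3: rewrite -(dom_mrev v) dom_id ?mrevK // => x y xy; rewrite !mrevE;
  apply: (@homo_lrpos leq (fun x => v x)); rewrite ?leqnn //=;
  [exact: leq_trans | exact/forallP | lia].
all: have := asc_sw v i; have := asc_le (sw v i); have := asc_le v.
  lia.
move=> l1 l2 e; right; rewrite -(dom_sw v i).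
have [|<-|] := IHd (sw v i); lia.
Qed.

End Combinatorics.

(** * Hecke relations and Yang-Baxter families *)

Lemma aq_field (F : fieldType) (t x : F) : 1 - t != 0 -> 1 - t * x != 0 ->
  t * ((1 - x) / (1 - t)) / ((1 - t * x) / (1 - t)) = (t - t * x) / (1 - t * x).
Proof. by move=> h1 h2; field; rewrite h1 h2. Qed.

Lemma bq_field (F : fieldType) (t x : F) : 1 - t != 0 -> 1 - x != 0 ->
  1 + t - (t - x) / (1 - x) = (1 - t * x) / (1 - t) / ((1 - x) / (1 - t)).
Proof. by move=> h1 h2; field; rewrite h1 h2. Qed.

(** The condition [yb_weight] for the scalars (t - t^k)/(1 - t^k), with x = t^k and y = t^l. *)
Lemma aq_yb (F : fieldType) (t x y : F) : 1 - x != 0 -> 1 - y != 0 -> 1 - x * y != 0 ->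
  (t - x * y) / (1 - x * y) * ((t - x) / (1 - x) + (t - y) / (1 - y)) -
    (1 + t) * ((t - x * y) / (1 - x * y)) -
    (t - x) / (1 - x) * ((t - y) / (1 - y)) + t = 0.
Proof. by move=> h1 h2 h3; field; rewrite h1 h2 h3. Qed.

(** The Yang-Baxter condition on scalars is invariant under a -> 1 + t - a, so the case of [bq]
    reduces to that of [aq]. *)
Lemma bq_yb (F : fieldType) (t x y z : F) :
  (1 + t - z) * ((1 + t - x) + (1 + t - y)) - (1 + t) * (1 + t - z) -
    (1 + t - x) * (1 + t - y) + t = z * (x + y) - (1 + t) * z - x * y + t.
Proof. ring. Qed.

Lemma q_unit_exp k : (0 < k)%N -> 1 - q ^+ k != 0 :> Qq.
Proof.
move=> k0; rewrite /q -tofrac1 -tofracXn -tofracB tofrac_eq0.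
apply/eqP => /(congr1 (fun p : {poly rat} => p.[0])) /eqP.
by rewrite !hornerE expr0n eqn0Ngt k0 /= subr0 oner_eq0.
Qed.

Lemma q1_neq0 : 1 - q != 0 :> Qq. Proof. by have := @q_unit_exp 1 isT; rewrite expr1. Qed.

#[local] Opaque q.

Definition aq (k : nat) : Qq := q * qint k.-1 / qint k.
(** Chosen so that nabla_i + [aq k] = sq_i - [bq k]. It is also the eigenvalue of sq_i - [aq k] on
    polynomials symmetric in x_i and x_(i+1). *)
Definition bq (k : nat) : Qq := 1 + q - aq k.

Lemma qint_neq0 k : (0 < k)%N -> qint k != 0.
Proof.
move=> k0; apply: mulf_neq0; first exact: q_unit_exp.
by rewrite invr_eq0; exact: q1_neq0.
Qed.

Lemma aqE k : aq k.+1 = (q - q ^+ k.+1) / (1 - q ^+ k.+1).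
Proof.
have := @q_unit_exp k.+1 isT; rewrite /aq /qint /= exprS => h.
exact: (aq_field q1_neq0 h).
Qed.

Lemma aq1 : aq 1 = 0. Proof. by rewrite aqE expr1 subrr mul0r. Qed.

(** These quotients of consecutive q-integers telescope to the factors of d_lambda in
    [zeta_weight]. *)
Lemma bqE k : bq k.+1 = qint k.+2 / qint k.+1.
Proof.
rewrite /bq aqE /qint [q ^+ k.+2]exprS.
exact: (bq_field q1_neq0 (@q_unit_exp k.+1 isT)).
Qed.

Lemma square_sym_ring (R : comNzRingType) (t x y f : R) :
  (1 + t) * f * (x - y) = (x - t * y) * f - (y - t * x) * f.
Proof. ring. Qed.

Lemma sym_square_ring (R : comNzRingType) (g g' x y h k : R) :
  g' * (y - x) = h - k -> g * (x - y) = k - h -> g' * (x - y) = g * (x - y).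
Proof. by rewrite -opprB mulrN -[h - k]opprB => /oppr_inj -> ->. Qed.

Lemma square_add_ring (R : comNzRingType) (a b d f g f' g' u v : R) :
  u * d = a * f - b * f' -> v * d = a * g - b * g' ->
  (u + v) * d = a * (f + g) - b * (f' + g').
Proof. by rewrite mulrDl => -> ->; rewrite !mulrDr opprD addrACA. Qed.

Lemma square_scale_ring (R : comNzRingType) (a b c d f f' u : R) :
  u * d = a * f - b * f' -> c * u * d = a * (c * f) - b * (c * f').
Proof. by rewrite -mulrA => ->; rewrite mulrBr !(mulrCA c). Qed.

(** The value of sq_i f in a field, g standing for f^(s_i). Relations between the sq_i become
    rational identities in which the conjugates of f are independent unknowns. *)
Definition hecke_frac (F : fieldType) (t x y f g : F) : F :=
  ((x - t * y) * f - (y - t * x) * g) / (x - y).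

Lemma frac_ring (R : comNzRingType) (F : fieldType) (phi : {rmorphism R -> F})
    (c h x y f g : R) : phi x - phi y != 0 ->
  h * (x - y) = (x - c * y) * f - (y - c * x) * g ->
  phi h = hecke_frac (phi c) (phi x) (phi y) (phi f) (phi g).
Proof.
move=> ne /(congr1 phi); rewrite !(rmorphM, rmorphB) => e.
exact: (canRL (mulfK ne)).
Qed.

Lemma phi_lin_ring (R : comNzRingType) (F : fieldType) (phi : {rmorphism R -> F})
  (a b c : R) : phi (a - c * b) = phi a - phi c * phi b.
Proof. by rewrite rmorphB rmorphM. Qed.

Lemma hecke_frac_comm (F : fieldType) (t x y z w f fi fj fij g g' h k k' l : F) :
  x - y != 0 -> z - w != 0 ->
  g = hecke_frac t z w f fj -> g' = hecke_frac t z w fi fij ->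
  h = hecke_frac t x y g g' ->
  k = hecke_frac t x y f fi -> k' = hecke_frac t x y fj fij ->
  l = hecke_frac t z w k k' -> h = l.
Proof.
rewrite /hecke_frac => h1 h2 -> -> -> -> -> ->.
by field; rewrite h1 h2.
Qed.

(** Given S^2 = (1 + t) S, the relation S1 S2 S1 - t S1 = S2 S1 S2 - t S2 is the braid relation for
    the Hecke generators S - 1. The elements f, fi, fj, fij, fji, w are the six conjugates of f
    under permutations of a, b, c. *)
Lemma hecke_frac_braid (F : fieldType) (t a b c f fi fj fij fji w : F)
  (A A' A'' B B' C E E' E'' G G' H : F) :
  a - b != 0 -> a - c != 0 -> b - c != 0 ->
  A = hecke_frac t a b f fi -> A' = hecke_frac t a c fj fji ->
  A'' = hecke_frac t b c fij w ->
  B = hecke_frac t b c A A' -> B' = hecke_frac t a c A A'' ->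
  C = hecke_frac t a b B B' ->
  E = hecke_frac t b c f fj -> E' = hecke_frac t a c fi fij ->
  E'' = hecke_frac t a b fji w ->
  G = hecke_frac t a b E E' -> G' = hecke_frac t a c E E'' ->
  H = hecke_frac t b c G G' ->
  C - t * A = H - t * E.
Proof.
rewrite /hecke_frac => h1 h2 h3 -> -> -> -> -> -> -> -> -> -> -> ->.
by field; rewrite h1 h2 h3.
Qed.

Lemma yb_comm_ring (R : comNzRingType) (S1 S2 : R -> R) (a b f : R) :
  {morph S1 : x y / x - y} -> {morph S2 : x y / x - y} ->
  {morph S1 : x / b * x} -> {morph S2 : x / a * x} ->
  S1 (S2 f) = S2 (S1 f) ->
  S1 (S2 f - b * f) - a * (S2 f - b * f) = S2 (S1 f - a * f) - b * (S1 f - a * f).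
Proof. by move=> B1 B2 Z1 Z2 c; rewrite B1 B2 Z1 Z2 c; ring. Qed.

(** After use of the quadratic and braid relations, the two sides differ by S1 f - S2 f times the
    scalar assumed to be zero. *)
Lemma yb_braid_ring (R : comNzRingType) (S1 S2 : R -> R) (t a b c f : R) :
  {morph S1 : x y / x - y} -> {morph S2 : x y / x - y} ->
  (forall d x, d \in [:: a; b; c] -> S1 (d * x) = d * S1 x) ->
  (forall d x, d \in [:: a; b; c] -> S2 (d * x) = d * S2 x) ->
  (forall x, S1 (S1 x) = (1 + t) * S1 x) ->
  (forall x, S2 (S2 x) = (1 + t) * S2 x) ->
  S1 (S2 (S1 f)) - t * S1 f = S2 (S1 (S2 f)) - t * S2 f ->
  b * (a + c) - (1 + t) * b - a * c + t = 0 ->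
  let D1 d x := S1 x - d * x in let D2 d x := S2 x - d * x in
  D1 c (D2 b (D1 a f)) = D2 a (D1 b (D2 c f)).
Proof.
move=> B1 B2 Z1 Z2 Q1 Q2 /(canRL (subrK _)) br e /=.
rewrite !(B1, B2) !Z1 ?inE ?eqxx ?orbT // !Z2 ?inE ?eqxx ?orbT //.
rewrite !(B1, B2) !Z1 ?inE ?eqxx ?orbT // !Z2 ?inE ?eqxx ?orbT //.
rewrite !(Q1, Q2) br; apply/eqP; rewrite -subr_eq0.
by rewrite -(mul0r (S1 f - S2 f)) -e; apply/eqP; ring.
Qed.

(** The scalar hypothesis of [yb_braid_ring] for gaps k, k + l and l. *)
Definition yb_weight (K : fieldType) (t : K) (al : nat -> K) :=
  forall k l, (0 < k)%N -> (0 < l)%N ->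
  al (k + l)%N * (al k + al l) - (1 + t) * al (k + l)%N - al k * al l + t = 0.

Lemma yb_weight_aq : yb_weight q aq.
Proof.
move=> [|k] [|l] // _ _; rewrite addSn !aqE -addSn exprD.
by apply: aq_yb; rewrite -?exprD q_unit_exp.
Qed.

Lemma yb_weight_bq : yb_weight q bq.
Proof. by move=> k l k0 l0; rewrite -(yb_weight_aq k0 l0) /bq bq_yb. Qed.

(** * Hecke relations for the operators sq_i *)

Section Hecke.
Variables (n : nat) (K : fieldType) (t : K).
Local Notation Pol := {mpoly K[n]}.
Implicit Types (i j : 'I_n.-1) (f g : Pol).

Lemma msymXU s (k : 'I_n) : msym s 'X_k = 'X_(s k) :> Pol.
Proof.
rewrite msymX; congr 'X_[_]; apply/mnmP => l; rewrite !mnmE.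
by rewrite (can2_eq (permK s) (permKV s)).
Qed.

Lemma mpolyX_inj (m1 m2 : 'X_{1..n}) : 'X_[m1] = 'X_[m2] :> Pol -> m1 = m2.
Proof.
move=> /(congr1 (mcoeff m1)); rewrite !mcoeffX eqxx.
by case: eqP => // _ /eqP; rewrite oner_eq0.
Qed.

Lemma XU_neq0 (k l : 'I_n) : k != l -> 'X_k - 'X_l != 0 :> Pol.
Proof.
move=> kl; rewrite subr_eq0; apply/eqP => /mpolyX_inj /mnmP /(_ k).
by rewrite !mnmE eqxx eq_sym (negbTE kl).
Qed.

Lemma lr_neq i : lpos i != rpos i.
Proof. by rewrite -(inj_eq val_inj) /=; lia. Qed.

Lemma msym_stranspK i f : msym (stransp i) (msym (stransp i) f) = f.
Proof. by rewrite -msymMm /stransp tperm2 msym1m. Qed.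

Variable sq : 'I_n.-1 -> Pol -> Pol.
Hypothesis squareP : forall i f, sq i f * ('X_(lpos i) - 'X_(rpos i)) =
  ('X_(lpos i) - t *: 'X_(rpos i)) * f -
  ('X_(rpos i) - t *: 'X_(lpos i)) * msym (stransp i) f.

(** Polynomials form a domain, so x_i - x_(i+1) cancels and [squareP] determines sq_i. The operator
    is handled through this equation alone. *)
Lemma square_eq i f g : g * ('X_(lpos i) - 'X_(rpos i)) =
  ('X_(lpos i) - t *: 'X_(rpos i)) * f -
  ('X_(rpos i) - t *: 'X_(lpos i)) * msym (stransp i) f -> sq i f = g.
Proof. by rewrite -squareP => /(mulIf (XU_neq0 (lr_neq i))). Qed.

Lemma squareD i f g : sq i (f + g) = sq i f + sq i g.
Proof.
apply: square_eq; rewrite msymD.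
exact: (square_add_ring (squareP i f) (squareP i g)).
Qed.

Lemma squareZ i c f : sq i (c *: f) = c *: sq i f.
Proof.
rewrite -!mul_mpolyC; apply: square_eq.
rewrite [c%:MP * f]mul_mpolyC msymZ -!(mul_mpolyC c).
exact: (square_scale_ring _ (squareP i f)).
Qed.

Lemma square0 i : sq i 0 = 0.
Proof. by rewrite -[X in sq i X](scale0r 0) squareZ scale0r. Qed.

Lemma squareB i f g : sq i (f - g) = sq i f - sq i g.
Proof. by rewrite squareD -scaleN1r squareZ scaleN1r. Qed.

Lemma square_sym i f : msym (stransp i) f = f -> sq i f = (1 + t) *: f.
Proof.
move=> e; apply: square_eq; rewrite e -!mul_mpolyC mpolyCD mpolyC1.
exact: square_sym_ring.
Qed.

Lemma msym_square_lhs s (k l : 'I_n) f :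
  msym s (f * ('X_k - 'X_l)) = msym s f * ('X_(s k) - 'X_(s l)).
Proof. by rewrite !(msymM, msymB, msymXU). Qed.

Lemma msym_square_rhs s (k l : 'I_n) f g :
  msym s (('X_k - t *: 'X_l) * f - ('X_l - t *: 'X_k) * g) =
  ('X_(s k) - t *: 'X_(s l)) * msym s f - ('X_(s l) - t *: 'X_(s k)) * msym s g.
Proof. by rewrite !(msymM, msymB, msymZ, msymXU). Qed.

Lemma sym_square i f : msym (stransp i) (sq i f) = sq i f.
Proof.
apply/(mulIf (XU_neq0 (lr_neq i))).
have := congr1 (msym (stransp i)) (squareP i f).
rewrite msym_square_lhs msym_square_rhs stranspL stranspR msym_stranspK.
by move=> e; exact: (sym_square_ring e (squareP i f)).
Qed.

Lemma square_quad i f : sq i (sq i f) = (1 + t) *: sq i f.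
Proof. exact/square_sym/sym_square. Qed.

Section Embedding.
Variables (F : fieldType) (phi : {rmorphism Pol -> F}) (phi_inj : injective phi).

Local Notation "p %:F" := (phi p).
Local Notation Q' := (phi (t%:MP)).

Let phi_subZ (g h : Pol) c : phi (g - c *: h) = phi g - phi c%:MP * phi h.
Proof. by rewrite -mul_mpolyC phi_lin_ring. Qed.

Lemma fracX_neq0 (k l : 'I_n) : k != l ->
  ('X_k : Pol)%:F - ('X_l : Pol)%:F != 0.
Proof. by move=> kl; rewrite -rmorphB raddf_eq0 // XU_neq0. Qed.

(** Applying s to the equation defining sq_i f keeps its shape and only renames the variables. *)
Lemma frac_square (s : 'S_n) i f (k l : 'I_n) g h :
  s (lpos i) = k -> s (rpos i) = l ->
  msym s f = g -> msym s (msym (stransp i) f) = h ->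
  phi (msym s (sq i f)) =
    hecke_frac (phi t%:MP) (phi 'X_k) (phi 'X_l) (phi g) (phi h).
Proof.
move=> <- <- <- <-; apply: frac_ring.
  by apply: fracX_neq0; rewrite (inj_eq perm_inj) lr_neq.
have := congr1 (msym s) (squareP i f).
by rewrite msym_square_lhs msym_square_rhs -!mul_mpolyC.
Qed.

Lemma frac_square2 (s1 s2 : 'S_n) i f (k l : 'I_n) g h :
  s2 (s1 (lpos i)) = k -> s2 (s1 (rpos i)) = l ->
  msym s2 (msym s1 f) = g -> msym s2 (msym s1 (msym (stransp i) f)) = h ->
  phi (msym s2 (msym s1 (sq i f))) =
    hecke_frac (phi t%:MP) (phi 'X_k) (phi 'X_l) (phi g) (phi h).
Proof.
move=> hk hl hg hh; apply: etrans (congr1 phi (esym (msymMm _ _ _))) _.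
apply: frac_square.
- by rewrite permM.
- by rewrite permM.
- by rewrite -hg; exact: msymMm.
- by rewrite -hh; exact: msymMm.
Qed.

Lemma frac_square1 i f (k l : 'I_n) : lpos i = k -> rpos i = l ->
  phi (sq i f) =
    hecke_frac (phi t%:MP) (phi 'X_k) (phi 'X_l) (phi f) (phi (msym (stransp i) f)).
Proof.
move=> <- <-; rewrite -[sq i f]msym1m.
by apply: frac_square; rewrite ?perm1 ?msym1m.
Qed.

Lemma stransp_id i (x : 'I_n) : x != lpos i -> x != rpos i -> stransp i x = x.
Proof. by move=> h1 h2; rewrite /stransp tpermD // eq_sym. Qed.

Lemma stransp_comm i j : (i.+1 < j)%N -> commute (stransp i) (stransp j).
Proof.
move=> ij; have := tpermJ (lpos i) (rpos i) (stransp j).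
rewrite !stransp_id -?(inj_eq val_inj) /=; [|lia..].
rewrite conjgE -/(stransp i) => e.
by rewrite /commute -{2}e !mulgA mulgV mul1g.
Qed.

Lemma stransp_braid i j : rpos i = lpos j ->
  (stransp i * (stransp j * stransp i) = stransp j * (stransp i * stransp j))%g.
Proof.
move=> ij; have ri : rpos j != lpos i.
  by rewrite -(inj_eq val_inj) /=; move: ij => /(congr1 (@nat_of_ord n)) /=; lia.
have n1 := lr_neq i; have n2 := lr_neq j; rewrite -ij in n2.
have := tpermJ (lpos i) (rpos i) (stransp j).
rewrite [stransp j (lpos i)]stransp_id -?ij // 1?eq_sym // ij stranspL -ij.
rewrite conjgE -/(stransp i) {1}/stransp tpermV -/(stransp j) => e.
have := tpermJ (rpos i) (rpos j) (stransp i).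
rewrite stranspR stransp_id // 1?eq_sym // ij -/(stransp j).
by rewrite conjgE {1}/stransp tpermV -/(stransp i) e.
Qed.

Lemma frac_square_comm i j f : (i.+1 < j)%N ->
  sq i (sq j f) = sq j (sq i f).
Proof.
move=> ij; apply: phi_inj.
have lj : lpos j != lpos i by rewrite -(inj_eq val_inj) /=; lia.
have lj' : lpos j != rpos i by rewrite -(inj_eq val_inj) /=; lia.
have rj : rpos j != lpos i by rewrite -(inj_eq val_inj) /=; lia.
have rj' : rpos j != rpos i by rewrite -(inj_eq val_inj) /=; lia.
have ni := fracX_neq0 (lr_neq i); have nj := fracX_neq0 (lr_neq j).
have ij_sym : msym (stransp j) (msym (stransp i) f) =
   msym (stransp i) (msym (stransp j) f).
  by rewrite -!msymMm (stransp_comm ij).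
apply: (@hecke_frac_comm F (phi t%:MP) (phi 'X_(lpos i)) (phi 'X_(rpos i))
  (phi 'X_(lpos j)) (phi 'X_(rpos j)) (phi f) (phi (msym (stransp i) f))
  (phi (msym (stransp j) f)) (phi (msym (stransp i) (msym (stransp j) f)))
  (phi (sq j f)) (phi (msym (stransp i) (sq j f)))
  (phi (sq i (sq j f))) (phi (sq i f))
  (phi (msym (stransp j) (sq i f))) (phi (sq j (sq i f))) ni nj).
- exact: frac_square1 (erefl _) (erefl _).
- apply: (@frac_square (stransp i) j f (lpos j) (rpos j)) (erefl _) (erefl _).
  + exact: stransp_id.
  + exact: stransp_id.
- exact: frac_square1 (erefl _) (erefl _).
- exact: frac_square1 (erefl _) (erefl _).
- apply: (@frac_square (stransp j) i f (lpos i) (rpos i)) (erefl _) ij_sym.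
  + by apply: stransp_id; rewrite eq_sym.
  + by apply: stransp_id; rewrite eq_sym.
- exact: frac_square1 (erefl _) (erefl _).
Qed.

Lemma frac_square_braid i j f : rpos i = lpos j ->
  sq i (sq j (sq i f)) - t *: sq i f =
  sq j (sq i (sq j f)) - t *: sq j f.
Proof.
move=> ij; apply: phi_inj.
have ri : rpos j != lpos i.
  by rewrite -(inj_eq val_inj) /=; move: ij => /(congr1 (@nat_of_ord n)) /=; lia.
have n1 := lr_neq i; have n2 := lr_neq j; rewrite -ij in n2.
have ab := fracX_neq0 n1; have bc := fracX_neq0 n2.
have ac : phi 'X_(lpos i) - phi 'X_(rpos j) != 0 by apply: fracX_neq0; rewrite eq_sym.
have ib : stransp i (rpos i) = lpos i by exact: stranspR.
have ia : stransp i (lpos i) = rpos i by exact: stranspL.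
have ic : stransp i (rpos j) = rpos j by apply: stransp_id => //; rewrite eq_sym.
have jb : stransp j (rpos i) = rpos j by rewrite ij stranspL.
have jc : stransp j (rpos j) = rpos i by rewrite ij stranspR.
have ja : stransp j (lpos i) = lpos i by apply: stransp_id; rewrite -?ij // eq_sym.
(* The sixth conjugate of f arises along both reduced words of the longest element of the group
   generated by s_i and s_j; the two must be recognised as one unknown. *)
have braid : msym (stransp i) (msym (stransp j) (msym (stransp i) f)) =
     msym (stransp j) (msym (stransp i) (msym (stransp j) f)).
  have mm s1 s2 s3 : msym s1 (msym s2 (msym s3 f)) = msym (s3 * (s2 * s1))%g f.
    by rewrite (msymMm f s3) (msymMm _ s2).
  apply: etrans (mm _ _ _) (etrans _ (esym (mm _ _ _))).
  by have e := stransp_braid ij; rewrite [in LHS]e.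
set a := lpos i in ri n1 ac ab ib ia ja; set b := rpos i in n1 n2 ab bc ib ia ic jb jc.
set c := rpos j in ri n2 bc ac ic jb jc.
have bE : b = lpos j by [].
have := @hecke_frac_braid F (phi t%:MP) (phi 'X_a) (phi 'X_b) (phi 'X_c)
  (phi f) (phi (msym (stransp i) f)) (phi (msym (stransp j) f))
  (phi (msym (stransp i) (msym (stransp j) f)))
  (phi (msym (stransp j) (msym (stransp i) f)))
  (phi (msym (stransp i) (msym (stransp j) (msym (stransp i) f))))
  (phi (sq i f)) (phi (msym (stransp j) (sq i f)))
  (phi (msym (stransp i) (msym (stransp j) (sq i f))))
  (phi (sq j (sq i f)))
  (phi (msym (stransp i) (sq j (sq i f))))
  (phi (sq i (sq j (sq i f))))
  (phi (sq j f)) (phi (msym (stransp i) (sq j f)))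
  (phi (msym (stransp j) (msym (stransp i) (sq j f))))
  (phi (sq i (sq j f)))
  (phi (msym (stransp j) (sq i (sq j f))))
  (phi (sq j (sq i (sq j f)))) ab ac bc.
move=> br.
apply: etrans (phi_subZ _ _ _) (etrans _ (esym (phi_subZ _ _ _))).
apply: br.
- exact: frac_square1 (erefl _) (erefl _).
- exact: frac_square ja jb (erefl _) (erefl _).
- apply: (@frac_square2 (stransp j) (stransp i) i f b c) (erefl _) (erefl _).
  + by rewrite ja.
  + by rewrite jb.
- exact: frac_square1 (esym bE) (erefl _).
- apply: (@frac_square (stransp i) j _ a c) (sym_square _ _) (erefl _) => //.
  by rewrite -bE.
- exact: frac_square1 (erefl _) (erefl _).
- exact: frac_square1 (esym bE) (erefl _).
- apply: (@frac_square (stransp i) j _ a c) (erefl _) (erefl _) => //.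
  by rewrite -bE.
- apply: (@frac_square2 (stransp i) (stransp j) j f a b) (erefl _) (esym braid).
  + by rewrite -bE ib.
  + by rewrite ic.
- exact: frac_square1 (erefl _) (erefl _).
- exact: (@frac_square (stransp j) i _ a c) ja jb (sym_square _ _) (erefl _).
- exact: frac_square1 (esym bE) (erefl _).
Qed.

End Embedding.

Lemma tofrac_mpoly_inj : injective (@tofrac Pol).
Proof. by move=> f g /eqP; rewrite tofrac_eq => /eqP. Qed.

Lemma square_comm i j f : (i.+1 < j)%N ->
  sq i (sq j f) = sq j (sq i f).
Proof. exact: (frac_square_comm tofrac_mpoly_inj). Qed.

Lemma square_braid i j f : rpos i = lpos j ->
  sq i (sq j (sq i f)) - t *: sq i f =
  sq j (sq i (sq j f)) - t *: sq j f.
Proof. exact: (frac_square_braid tofrac_mpoly_inj). Qed.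

(** * Existence of Yang-Baxter families *)

Variables (al : nat -> K) (al_yb : yb_weight t al).

Definition ybop i (k : nat) f := sq i f - al k *: f.

Lemma square_mulC i c f : sq i (c%:MP * f) = c%:MP * sq i f.
Proof. by rewrite !mul_mpolyC squareZ. Qed.

Lemma ybop_comm i j k l f : (i.+1 < j)%N ->
  ybop i k (ybop j l f) = ybop j l (ybop i k f).
Proof.
move=> ij; rewrite /ybop -!mul_mpolyC.
exact: (yb_comm_ring (squareB i) (squareB j) (square_mulC i (al l))
  (square_mulC j (al k)) (square_comm f ij)).
Qed.

Lemma ybop_braid i j k l f : rpos i = lpos j -> (0 < k)%N -> (0 < l)%N ->
  ybop i l (ybop j (k + l)%N (ybop i k f)) =
  ybop j k (ybop i (k + l)%N (ybop j l f)).
Proof.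
move=> ij k0 l0; rewrite /ybop -!mul_mpolyC.
have w : (al (k + l)%N)%:MP * ((al k)%:MP + (al l)%:MP) -
   (1 + t%:MP) * (al (k + l)%N)%:MP - (al k)%:MP * (al l)%:MP + t%:MP = 0 :> Pol.
  have := congr1 (@mpolyC n K) (al_yb k0 l0).
  by rewrite mpolyC0 !(mpolyCD, mpolyCN, mpolyCM, mpolyC1).
apply: (yb_braid_ring (squareB i) (squareB j) _ _ _ _ _ w).
- by move=> d x; rewrite !inE => /or3P[] /eqP ->; exact: square_mulC.
- by move=> d x; rewrite !inE => /or3P[] /eqP ->; exact: square_mulC.
- by move=> x; rewrite square_quad -mul_mpolyC mpolyCD mpolyC1.
- by move=> x; rewrite square_quad -mul_mpolyC mpolyCD mpolyC1.
- by have := square_braid f ij; rewrite -!mul_mpolyC.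
Qed.

(* Follows the descents chosen by [pick]; ybrec_diamond is the confluence of this choice. *)
Fixpoint ybrec (m : nat) (s : 'S_n) (f : Pol) : Pol :=
  if m is m'.+1 then
    if [pick i | (s (rpos i) < s (lpos i))%N] is Some i then
      ybop i (s (lpos i) - s (rpos i))%N (ybrec m' (stransp i * s)%g f)
    else f
  else f.

Lemma plength_desc i (s : 'S_n) m : plength s = m.+1 ->
  (s (rpos i) < s (lpos i))%N -> plength (stransp i * s)%g = m.
Proof. by have := plength_stransp i s; lia. Qed.

Lemma plength0_desc i (s : 'S_n) : plength s = 0%N -> (s (lpos i) < s (rpos i))%N.
Proof.
by have := plength_stransp i s; have := perm_lr_neq i s;
  rewrite -(inj_eq val_inj) /=; lia.
Qed.

(** Distant descents commute. For adjacent ones, both paths are prolonged by two further descents to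
    a common permutation and compared by [ybop_braid]; the hypothesis on smaller lengths allows
    these descents to be chosen at will. *)
Lemma ybrec_diamond m (s : 'S_n) i j f : (i <= j)%N -> plength s = m.+1 ->
  (forall m' s i, (m' < m)%N -> plength s = m'.+1 -> (s (rpos i) < s (lpos i))%N ->
    ybrec m'.+1 s f = ybop i (s (lpos i) - s (rpos i))%N (ybrec m' (stransp i * s)%g f)) ->
  (s (rpos i) < s (lpos i))%N -> (s (rpos j) < s (lpos j))%N ->
  ybop i (s (lpos i) - s (rpos i))%N (ybrec m (stransp i * s)%g f) =
  ybop j (s (lpos j) - s (rpos j))%N (ybrec m (stransp j * s)%g f).
Proof.
move=> ij sm IH hi hj.
have [/val_inj -> //|ij2] := eqVneq (i : nat) j.
have li := plength_desc sm hi; have lj := plength_desc sm hj.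
have [ij3|ij3] := ltnP i.+1 j.
  have lj1 : lpos j != lpos i by rewrite -(inj_eq val_inj) /=; lia.
  have lj2 : lpos j != rpos i by rewrite -(inj_eq val_inj) /=; lia.
  have rj1 : rpos j != lpos i by rewrite -(inj_eq val_inj) /=; lia.
  have rj2 : rpos j != rpos i by rewrite -(inj_eq val_inj) /=; lia.
  case: m => [|m] in sm IH li lj *.
    by have := plength0_desc j li; rewrite !permM !stransp_id //; lia.
  rewrite (IH m _ j _ li) //; last by rewrite !permM !stransp_id.
  rewrite (IH m _ i _ lj) //; last by rewrite !permM !stransp_id // 1?eq_sym.
  rewrite !permM ![stransp i _]stransp_id // ![stransp j _]stransp_id // 1?eq_sym //.
  by rewrite ybop_comm // !mulgA (stransp_comm ij3).
have rl : rpos i = lpos j by apply: val_inj => /=; lia.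
have n1 := lr_neq i; have n2 := lr_neq j; rewrite -rl in n2.
have ri : rpos j != lpos i by rewrite -(inj_eq val_inj) /=; lia.
have ib : stransp i (rpos i) = lpos i by exact: stranspR.
have ia : stransp i (lpos i) = rpos i by exact: stranspL.
have ic : stransp i (rpos j) = rpos j by apply: stransp_id => //; rewrite eq_sym.
have jb : stransp j (rpos i) = rpos j by rewrite rl stranspL.
have jc : stransp j (rpos j) = rpos i by rewrite rl stranspR.
have ja : stransp j (lpos i) = lpos i by apply: stransp_id; rewrite -?rl // eq_sym.
have braid : (stransp i * (stransp j * stransp i) = stransp j * (stransp i * stransp j))%g.
  exact: stransp_braid.
rewrite -rl in hj *.
case: m => [|m] in sm IH li lj *.
  by have := plength0_desc j li; rewrite !permM -rl ib ic; lia.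
rewrite (IH m _ j _ li) //; last by rewrite !permM -rl ib ic; lia.
rewrite (IH m _ i _ lj) //; last by rewrite !permM ja jb; lia.
rewrite !permM -!rl ib ic ja jb.
have li' : plength (stransp j * (stransp i * s))%g = m.
  by apply: plength_desc li _; rewrite !permM -rl ib ic; lia.
have lj' : plength (stransp i * (stransp j * s))%g = m.
  by apply: plength_desc lj _; rewrite !permM ja jb; lia.
case: m => [|m] in sm IH li lj li' lj' *.
  by have := plength0_desc i li'; rewrite !permM ja jb ia ic; lia.
rewrite (IH m _ i _ li') //; last by rewrite !permM ja jb ia ic; lia.
rewrite (IH m _ j _ lj') //; last by rewrite !permM -rl ib ic ja jc; lia.
rewrite !permM -!rl ib ic ja jb jc ia ic.
(* The gap between the outer entries is the sum of the two inner gaps, the additivity built into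
   [yb_weight]. *)
have -> : (s (lpos i) - s (rpos j) =
  (s (rpos i) - s (rpos j)) + (s (lpos i) - s (rpos i)))%N by lia.
rewrite ybop_braid //; try lia.
by rewrite !mulgA -(mulgA (stransp i)) braid !mulgA.
Qed.

Lemma ybrecE m (s : 'S_n) i f : plength s = m.+1 -> (s (rpos i) < s (lpos i))%N ->
  ybrec m.+1 s f = ybop i (s (lpos i) - s (rpos i))%N (ybrec m (stransp i * s)%g f).
Proof.
elim/ltn_ind: m s i => m IH s i sm hi /=.
case: pickP => [j hj|/(_ i)]; last by rewrite hi.
have IH' m' s' i' mm := IH m' mm s' i'.
by case: (leqP i j) => [ij|/ltnW ji]; [apply/esym|];
  apply: ybrec_diamond => // *; exact: IH'.
Qed.

(** [yang_baxter] picks a family by choice, so the recursion holds for [Y] and [Yhat] only once some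
    family is known to exist. *)
Lemma ybop_family_ex : exists Z : 'S_n -> Pol -> Pol, (forall f, Z 1%g f = f) /\
  forall s i, (plength s < plength (stransp i * s)%g)%N -> forall f,
    Z (stransp i * s)%g f = ybop i (s (rpos i) - s (lpos i))%N (Z s f).
Proof.
exists (fun s => ybrec (plength s) s); split=> [f|s i h f].
  by rewrite plength1.
have h' := h; rewrite plength_lt in h'.
have e := plength_stransp i s; have e' : plength (stransp i * s)%g = (plength s).+1 by lia.
rewrite e' (@ybrecE _ _ i) // ?stransp_mulK; last by rewrite !permM stranspL stranspR.
by rewrite !permM stranspL stranspR.
Qed.

End Hecke.

(** * The families Y and Yhat as instances *)

Section Families.
Variable n : nat.
Local Notation Pol := {mpoly Qq[n]}.
Implicit Types (i j : 'I_n.-1) (f g : Pol).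

Lemma squareP i f : square i f * ('X_(lpos i) - 'X_(rpos i)) =
  ('X_(lpos i) - q *: 'X_(rpos i)) * f -
  ('X_(rpos i) - q *: 'X_(lpos i)) * msym (stransp i) f.
Proof.
rewrite /square ddiffP msymM; congr (_ - _ * _).
by rewrite msymB msymZ !msymXU stranspL stranspR.
Qed.

Definition ybD (al : nat -> Qq) i k f := square i f - al k *: f.

Lemma Y_family : yang_baxter_family (ybD aq) (@Y n).
Proof. exact: (xgetPex _ (ybop_family_ex squareP yb_weight_aq)). Qed.

Lemma nabla_bq i k f : nabla i f + (q * qint k.-1 / qint k) *: f = ybD bq i k f.
Proof.
rewrite /nabla /ybD /bq -/(aq k); move: (square i f) (aq k) => g a.
by rewrite scalerBl opprB addrA addrAC.
Qed.

Lemma Yhat_family : yang_baxter_family (ybD bq) (@Yhat n).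
Proof.
rewrite /Yhat; have -> : (fun i k f => nabla i f + (q * qint k.-1 / qint k) *: f) =
    ybD bq by do 3 apply: funext => ?; exact: nabla_bq.
exact: (xgetPex _ (ybop_family_ex squareP yb_weight_bq)).
Qed.

End Families.

(** * The kernel of the scalar product *)

Lemma fsumT_seq (V : nmodType) (T : choiceType) (r : seq T) (F : T -> V) :
  uniq r -> (forall x, x \notin r -> F x = 0) ->
  \sum_(x \in classical_sets.setT) F x = \sum_(x <- r) F x.
Proof.
move=> ur h; rewrite (fsbigE r) //; last by move=> x _; exact: h.
by apply: eq_bigl => x; rewrite classical_sets.in_setT.
Qed.

Lemma sum_if_eq (V : nmodType) (T : eqType) (r : seq T) (x : T) (F : T -> V) :
  uniq r -> x \in r -> \sum_(y <- r) (if y == x then F y else 0) = F x.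
Proof.
move=> ur xr; rewrite (bigD1_seq x) //= eqxx big1 ?addr0 // => y /negbTE -> //.
Qed.

Section Kernel.
Variable n : nat.
Local Notation expo := (expo n).
Local Notation series := (series n).
Implicit Types (s : 'S_n) (i j x y : 'I_n) (d e : expo) (A B : series) (w : 'I_n -> int)
  (p : 'I_n * 'I_n) (l : seq ('I_n * 'I_n)).

Definition wt w e : int := \sum_x w x * e x.

Lemma wtD w d e : wt w (d + e) = wt w d + wt w e.
Proof.
by rewrite /wt -big_split; apply: eq_bigr => x _; rewrite ffunE mulrDr.
Qed.
Lemma wt0 w : wt w 0 = 0.
Proof. by rewrite /wt big1 // => x _; rewrite ffunE mulr0. Qed.
Lemma wtN w e : wt w (- e) = - wt w e.
Proof. by apply/eqP; rewrite -addr_eq0 -wtD addNr wt0. Qed.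
Lemma wtB w d e : wt w (d - e) = wt w d - wt w e.
Proof. by rewrite wtD wtN. Qed.
Lemma wtMn w e k : wt w (e *+ k) = wt w e *+ k.
Proof. by elim: k => [|k IH]; rewrite ?mulr0n ?wt0 // !mulrS wtD IH. Qed.

Lemma wt_ratio w i j : wt w (ratio i j) = w i - w j.
Proof.
rewrite /wt; under eq_bigr do rewrite ffunE mulrBr.
rewrite sumrB (bigD1 i) //= [X in _ - X](bigD1 j) //= !eqxx !mulr1.
by rewrite !big1 ?addr0 // => x /negbTE ->; rewrite mulr0.
Qed.

Lemma ratio_inj i j : i != j -> injective (fun k => ratio i j *+ k).
Proof.
move=> ij k1 k2 /(congr1 (wt (fun x => (x == i)%:Z))); rewrite !wtMn wt_ratio eqxx.
by rewrite eq_sym (negbTE ij) subr0 !pmulrn !intz => -[].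
Qed.

(** The coefficients of (1 - z)/(1 - q z) as a power series in z. *)
Definition geomc (k : nat) : Qq := if k is k'.+1 then q ^+ k - q ^+ k' else 1.
Definition factor i j : series :=
  smul (fun e => smon 0 e - smon (ratio i j) e) (sgeom i j).
Definition theta p A := smul (factor p.1 p.2) A.
(* Support in a half-space, which makes the products by geometric series finite. *)
Definition lower w A := forall e, wt w e < 0 -> A e = 0.

Lemma sgeomE i j k : i != j -> sgeom i j (ratio i j *+ k) = q ^+ k.
Proof.
move=> ij; rewrite /sgeom (@fsumT_seq _ _ [:: k]) ?big_seq1 // /smon.
  by rewrite eqxx mulr1.
by move=> m; rewrite inE (inj_eq (ratio_inj ij)) eq_sym => /negbTE ->; rewrite mulr0.
Qed.

Lemma sgeom0 i j e : (forall k, e != ratio i j *+ k) -> sgeom i j e = 0.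
Proof. by move=> h; apply: fsbig1 => k _; rewrite /smon (negbTE (h k)) mulr0. Qed.

Lemma factorE i j e : i != j ->
  factor i j e = sgeom i j e - sgeom i j (e - ratio i j).
Proof.
move=> ij; have r0 : ratio i j != 0.
  by have /inj_eq/(_ 1%N 0%N) := ratio_inj ij; rewrite mulr1n mulr0n => ->.
rewrite /factor /smul (@fsumT_seq _ _ [:: 0; ratio i j]) /=; last 2 first.
- by rewrite inE eq_sym r0.
- by move=> d; rewrite !inE negb_or /smon => /andP[/negbTE -> /negbTE ->];
    rewrite subrr mul0r.
rewrite big_cons big_seq1 /smon !eqxx [0 == _]eq_sym (negbTE r0).
by rewrite !subr0 mul1r sub0r mulN1r.
Qed.

Lemma factor_ratio i j k : i != j -> factor i j (ratio i j *+ k) = geomc k.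
Proof.
move=> ij; rewrite factorE // sgeomE //; case: k => [|k] /=.
  rewrite expr0 sgeom0 ?subr0 // => k; rewrite mulr0n sub0r.
  apply/eqP => e; have : ratio i j *+ k.+1 = ratio i j *+ 0 by rewrite mulrS -e subrr.
  by move/(ratio_inj ij).
by rewrite mulrSr addrK sgeomE.
Qed.

Lemma factor0 i j e : i != j -> (forall k, e != ratio i j *+ k) -> factor i j e = 0.
Proof.
move=> ij h; rewrite factorE // !sgeom0 ?subrr // => k.
by rewrite subr_eq -mulrSr.
Qed.

(** The ratio has weight at least 1, so removing N or more copies of it from e leaves a negative
    weight, where A vanishes. Any large N serves, so that several sums can share a bound. *)
Lemma sum_ratio w i j (C A : series) e N :
  (forall d, (forall k, d != ratio i j *+ k) -> C d = 0) ->
  w j < w i -> lower w A -> wt w e < N%:Z ->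
  smul C A e = \sum_(0 <= k < N) C (ratio i j *+ k) * A (e - ratio i j *+ k).
Proof.
move=> C0 wij lA eN; have ij : i != j by apply: contraTneq wij => ->; rewrite ltxx.
rewrite /smul (@fsumT_seq _ _ [seq ratio i j *+ k | k <- index_iota 0 N]).
- by rewrite big_map.
- by rewrite map_inj_uniq ?iota_uniq //; exact: ratio_inj.
move=> d dN; have [[k dk]|dk] := pselect (exists k, d = ratio i j *+ k); last first.
  by rewrite C0 ?mul0r // => k; apply/eqP => e'; apply: dk; exists k.
rewrite lA ?mulr0 // wtB dk wtMn wt_ratio subr_lt0 (lt_le_trans eN) //.
have kN : (N <= k)%N.
  rewrite leqNgt; apply: contra dN => kN; apply/mapP; exists k => //.
  by rewrite mem_index_iota.
have : 1 <= w i - w j by move: wij; lia.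
move: (w i - w j) => a a1; rewrite -mulr_natr; nia.
Qed.

Lemma theta_sum w p A e N : w p.2 < w p.1 -> lower w A -> wt w e < N%:Z ->
  theta p A e = \sum_(0 <= k < N) geomc k * A (e - ratio p.1 p.2 *+ k).
Proof.
move=> wp lA eN; have ij : p.1 != p.2 by apply: contraTneq wp => ->; rewrite ltxx.
rewrite /theta (sum_ratio (fun d => @factor0 _ _ d ij) wp lA eN).
by apply: eq_bigr => k _; rewrite factor_ratio.
Qed.

Lemma theta_lower w p A : p.1 != p.2 -> w p.2 <= w p.1 -> lower w A ->
  lower w (theta p A).
Proof.
move=> ij wp lA e we; apply: fsbig1 => d _.
have [[k dk]|dk] := pselect (exists k, d = ratio p.1 p.2 *+ k); last first.
  by rewrite factor0 ?mul0r // => k; apply/eqP => e'; apply: dk; exists k.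
rewrite lA ?mulr0 // wtB dk wtMn wt_ratio.
have : 0 <= w p.1 - w p.2 by move: wp; lia.
move: (w p.1 - w p.2) => a a0; rewrite -mulr_natr; nia.
Qed.

Lemma theta_comm w p p' A : w p.2 < w p.1 -> w p'.2 < w p'.1 -> lower w A ->
  theta p (theta p' A) = theta p' (theta p A).
Proof.
move=> wp wp' lA; apply: funext => e.
have ij : p.1 != p.2 by apply: contraTneq wp => ->; rewrite ltxx.
have ij' : p'.1 != p'.2 by apply: contraTneq wp' => ->; rewrite ltxx.
have lA1 : lower w (theta p A) by apply: theta_lower => //; exact: ltW.
have lA2 : lower w (theta p' A) by apply: theta_lower => //; exact: ltW.
have [N eN] : exists N, wt w e < N%:Z by exists (absz (wt w e)).+1; lia.
have sub i j k : w j < w i -> wt w (e - ratio i j *+ k) < N%:Z.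
  rewrite wtB wtMn wt_ratio => h; have : 0 <= w i - w j by move: h; lia.
  by move: (w i - w j) => a a0; rewrite -mulr_natr; nia.
rewrite (theta_sum wp lA2 eN) (theta_sum wp' lA1 eN).
under eq_bigr do rewrite (theta_sum wp' lA (sub _ _ _ wp)) big_distrr /=.
rewrite exchange_big /=; apply: eq_bigr => k _.
rewrite (theta_sum wp lA (sub _ _ _ wp')) big_distrr /=; apply: eq_bigr => m _.
by rewrite mulrCA addrAC.
Qed.

Definition kprod l : series := \big[@smul n/smon 0]_(p <- l) factor p.1 p.2.

Lemma kprod_cons p l : kprod (p :: l) = theta p (kprod l).
Proof. by rewrite /kprod big_cons. Qed.

Lemma smon0_lower w : lower w (smon 0 : series).
Proof.
by move=> e we; rewrite /smon; case: eqP we => // ->; rewrite wt0 ltxx.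
Qed.

Lemma kprod_lower w l :
  (forall p, p \in l -> p.1 != p.2 /\ w p.2 <= w p.1) -> lower w (kprod l).
Proof.
elim: l => [|p l IH] h; first by rewrite /kprod big_nil; exact: smon0_lower.
have [h1 h2] := h p (mem_head _ _).
rewrite kprod_cons; apply: theta_lower => //; apply: IH => p' p'l; apply: h.
by rewrite inE p'l orbT.
Qed.

Definition wpos w l := forall p, p \in l -> w p.2 < w p.1.

Lemma wpos_lower w l : wpos w l -> lower w (kprod l).
Proof.
move=> h; apply: kprod_lower => p /h wp; split; last exact: ltW.
by apply: contraTneq wp => ->; rewrite ltxx.
Qed.

Lemma kprod_mid w l1 l2 p : wpos w (l1 ++ p :: l2) ->
  kprod (l1 ++ p :: l2) = theta p (kprod (l1 ++ l2)).
Proof.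
elim: l1 => [|p' l1 IH] h /=; first by rewrite kprod_cons.
have wp : w p.2 < w p.1 by apply: h; rewrite inE mem_cat inE eqxx !orbT.
have wp' : w p'.2 < w p'.1 by apply: h; rewrite inE eqxx.
have ht : wpos w (l1 ++ p :: l2) by move=> r rl; apply: h; rewrite inE rl orbT.
rewrite !kprod_cons IH // (theta_comm wp' wp) // -?kprod_cons //.
apply: wpos_lower => r rl; apply: ht; move: rl; rewrite !mem_cat inE.
by case/orP => ->; rewrite ?orbT.
Qed.

(** In [smul] a sum with infinitely many nonzero terms counts as 0, so factors cannot be rearranged
    unconditionally. A weight positive on every root of the list makes all the sums finite, and
    [theta_comm] exchanges them. *)
Lemma kprod_perm w l1 l2 : perm_eq l1 l2 -> wpos w l1 -> kprod l1 = kprod l2.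
Proof.
elim: l1 l2 => [|p l1 IH] l2 pe h.
  by move/perm_size/esym/size0nil: pe => ->.
have pl2 : p \in l2 by rewrite -(perm_mem pe) mem_head.
have h2 : wpos w l2 by move=> r rl; apply: h; rewrite (perm_mem pe).
move: pe h2; case/splitPr: pl2 => a b pe h2.
rewrite kprod_cons (kprod_mid h2); congr theta; apply: IH.
  by move: pe; rewrite perm_sym perm_catC /= perm_cons perm_catC perm_sym.
by move=> r rl; apply: h; rewrite inE rl orbT.
Qed.

Definition eact (s : 'S_n) e : expo := [ffun x => e (s x)].

Lemma eactK s : cancel (eact s) (eact s^-1%g).
Proof. by move=> e; apply/ffunP => x; rewrite !ffunE permKV. Qed.
Lemma eactVK s : cancel (eact s^-1%g) (eact s).
Proof. by move=> e; apply/ffunP => x; rewrite !ffunE permK. Qed.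
Lemma eactB s d e : eact s (d - e) = eact s d - eact s e.
Proof. by apply/ffunP => x; rewrite !ffunE. Qed.
Lemma eactD s d e : eact s (d + e) = eact s d + eact s e.
Proof. by apply/ffunP => x; rewrite !ffunE. Qed.
Lemma eact0 s : eact s 0 = 0.
Proof. by apply/ffunP => x; rewrite !ffunE. Qed.

Lemma eact_bij s : bijective (eact s).
Proof. by exists (eact s^-1%g); [exact: eactK | exact: eactVK]. Qed.

Lemma eact_ratio (s : 'S_n) i j k : eact s (ratio (s i) (s j) *+ k) = ratio i j *+ k.
Proof.
elim: k => [|k IH]; first by rewrite !mulr0n eact0.
rewrite !mulrSr eactD IH; congr (_ + _).
by apply/ffunP => x; rewrite !ffunE !(inj_eq perm_inj).
Qed.

Lemma smul_eact s A B e :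
  smul A B (eact s e) = smul (fun d => A (eact s d)) (fun d => B (eact s d)) e.
Proof.
rewrite /smul (@reindex_fsbig _ _ _ _ _ (eact s) classical_sets.setT).
  by apply: eq_fsbigr => d _; rewrite eactB.
split=> // [x y _ _|d _]; first exact: (bij_inj (eact_bij s)).
by exists (eact s^-1%g d) => //; exact: eactVK.
Qed.

Lemma smul_ext A A' B B' e : A =1 A' -> B =1 B' -> smul A B e = smul A' B' e.
Proof. by move=> /funext -> /funext ->. Qed.

Lemma smon_eact s d e : smon (eact s d) (eact s e) = smon d e.
Proof. by rewrite /smon (inj_eq (bij_inj (eact_bij s))). Qed.

Lemma sgeom_eact (s : 'S_n) i j e : sgeom (s i) (s j) e = sgeom i j (eact s e).
Proof.
by apply: eq_fsbigr => k _; rewrite -(smon_eact s) eact_ratio.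
Qed.

Lemma factor_eact (s : 'S_n) i j e : factor (s i) (s j) e = factor i j (eact s e).
Proof.
rewrite /factor smul_eact; apply: smul_ext => d; last exact: sgeom_eact.
rewrite -[smon 0 d](smon_eact s) eact0 -[smon (ratio (s i) _) d](smon_eact s).
by rewrite -[ratio (s i) _]mulr1n eact_ratio mulr1n.
Qed.

Lemma kprod_eact s l e :
  kprod [seq (s p.1, s p.2) | p <- l] e = kprod l (eact s e).
Proof.
elim: l e => [|p l IH] e /=.
  by rewrite /kprod !big_nil -(smon_eact s) eact0.
rewrite !kprod_cons /theta smul_eact; apply: smul_ext => d; first exact: factor_eact.
exact: IH.
Qed.

Definition pairs : seq ('I_n * 'I_n) :=
  [seq p : 'I_n * 'I_n <- index_enum _ | (p.1 < p.2)%N].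

Lemma qkernelE : @qkernel n = kprod pairs.
Proof. by rewrite /qkernel /kprod /pairs big_filter. Qed.

Lemma mem_pairs p : (p \in pairs) = (p.1 < p.2)%N.
Proof. by rewrite mem_filter mem_index_enum andbT. Qed.

Lemma pairs_uniq : uniq pairs.
Proof. by rewrite filter_uniq // index_enum_uniq. Qed.

(** A weakly decreasing weight is non-negative on every x_i/x_j with i < j. Letting w vary, this
    confines the support of the kernel to the positive root cone. *)
Lemma qkernel_lower w : (forall x y, (x <= y)%N -> w y <= w x) -> lower w (@qkernel n).
Proof.
move=> h; rewrite qkernelE; apply: kprod_lower => p; rewrite mem_pairs => p12; split.
  by rewrite -(inj_eq val_inj) /= ltn_eqF.
exact/h/ltnW.
Qed.

(** Strictly positive on every x_i/x_j with i < j, hence usable for any sublist of [pairs]. *)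
Let w0 x : int := - (x : nat)%:Z.

Lemma w0_pairs l : {subset l <= pairs} -> wpos w0 l.
Proof. by move=> h p /h; rewrite mem_pairs /w0; lia. Qed.

Lemma qkernel0 : @qkernel n 0 = 1.
Proof.
rewrite qkernelE; have := w0_pairs (fun p (h : p \in pairs) => h).
elim: pairs => [|p l IH] h; first by rewrite /kprod big_nil /smon eqxx.
(* The exponent 0 has weight below 1, so only the term k = 0 of the factor survives. *)
rewrite kprod_cons (@theta_sum w0 _ _ _ 1) ?wt0 //.
- rewrite big_nat1 mul1r mulr0n subr0; apply: IH => r rl.
  by apply: h; rewrite inE rl orbT.
- by apply: h; rewrite mem_head.
- by apply: wpos_lower => r rl; apply: h; rewrite inE rl orbT.
Qed.

(** * The kernel along one simple root *)

Section SimpleRoot.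
Variable i : 'I_n.-1.
Local Notation alpha := (ratio (lpos i) (rpos i)).

Let p0 := (lpos i, rpos i).
(* Writing the kernel as (1 - z) / (1 - q z) times kprod', with z = x_i/x_(i+1), *)
(* kprod' is invariant under s_i, and kgeom = kprod' / (1 - q z).              *)
Definition kprod' := kprod (rem p0 pairs).
Definition kgeom : series := smul (sgeom (lpos i) (rpos i)) kprod'.

Lemma p0_pairs : p0 \in pairs.
Proof. by rewrite mem_pairs /=. Qed.

Lemma w0_rem : wpos w0 (rem p0 pairs).
Proof. by apply: w0_pairs => p /mem_rem. Qed.

Lemma w0_lr : w0 (rpos i) < w0 (lpos i). Proof. by rewrite /w0 /=; lia. Qed.

Lemma qkernel_rem : @qkernel n = theta p0 kprod'.
Proof.
rewrite qkernelE -kprod_cons; apply: (@kprod_perm w0); first exact: perm_to_rem p0_pairs.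
exact: w0_pairs.
Qed.

(** s_i permutes the positive roots other than x_i/x_(i+1), hence the factors of [kprod']. *)
Lemma kprod'_sym e : kprod' (eact (stransp i) e) = kprod' e.
Proof.
rewrite /kprod' -kprod_eact; congr (_ e).
(* A weight constant on the orbits of s_i and still positive on the other roots. *)
pose w1 x : int := - (nat_of_ord (if x == rpos i then lpos i else x))%:Z.
apply: (@kprod_perm w1).
  apply: uniq_perm; rewrite ?rem_uniq ?pairs_uniq // ?map_inj_uniq ?rem_uniq ?pairs_uniq //.
    by move=> [a b] [c d] /= [/perm_inj -> /perm_inj ->].
  have inr p : (p \in rem p0 pairs) = (p != p0) && (p.1 < p.2)%N.
    by rewrite (mem_rem_uniq _ pairs_uniq) inE mem_pairs.
  move=> p; rewrite inr; apply/mapP/andP => [[r]|[h1 h2]].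
    rewrite inr => /andP[h1 h2] -> /=; split; last first.
      by apply: stransp_ltn => //; move: h1; rewrite -{1}[r]surjective_pairing.
    apply: contraTneq h2 => -[/(canRL (stranspK i)) -> /(canRL (stranspK i)) ->].
    by rewrite stranspL stranspR /=; lia.
  exists (stransp i p.1, stransp i p.2); last by rewrite !stranspK -surjective_pairing.
  rewrite inr /=; apply/andP; split; last first.
    by apply: stransp_ltn => //; move: h1; rewrite -{1}[p]surjective_pairing.
  apply: contraTneq h2 => -[/(canRL (stranspK i)) -> /(canRL (stranspK i)) ->].
  by rewrite stranspL stranspR /=; lia.
move=> p /mapP[r rl ->] /=.
have h1 : r != p0 by move: rl; rewrite (mem_rem_uniq _ pairs_uniq) inE => /andP[].
have h2 : (r.1 < r.2)%N by rewrite -mem_pairs; exact: mem_rem rl.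
have w1t x : w1 (stransp i x) = w1 x.
  rewrite /w1 /stransp; case: tpermP => [->|->|_ _] //.
  - by rewrite eqxx (negbTE (lr_neq i)).
  - by rewrite eqxx (negbTE (lr_neq i)).
rewrite !w1t /w1; move: h1; rewrite [r]surjective_pairing xpair_eqE.
move: r.1 r.2 h2 => a b; rewrite -!(inj_eq val_inj) /=.
by case: ifP => e1; case: ifP => e2; move: e1 e2; rewrite /=; lia.
Qed.

Lemma kgeom_sum e N : wt w0 e < N%:Z ->
  kgeom e = \sum_(0 <= k < N) q ^+ k * kprod' (e - alpha *+ k).
Proof.
move=> eN; rewrite /kgeom (sum_ratio _ w0_lr (wpos_lower w0_rem) eN).
  by apply: eq_bigr => k _; rewrite sgeomE // lr_neq.
by move=> d; exact: sgeom0.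
Qed.

Lemma wt_alpha e N : wt w0 e < N%:Z -> wt w0 (e - alpha) < N%:Z.
Proof. by rewrite wtB wt_ratio; have := w0_lr; lia. Qed.

Lemma kgeomS e N : wt w0 e < N%:Z ->
  kgeom e = kprod' e + \sum_(0 <= k < N) q ^+ k.+1 * kprod' (e - alpha - alpha *+ k).
Proof.
move=> eN; rewrite (@kgeom_sum e N.+1) ?big_nat_recl // ?mul1r ?mulr0n ?subr0; last by lia.
congr (_ + _); apply: eq_bigr => k _.
by rewrite mulrS opprD addrA.
Qed.

Lemma kprod'E e : kprod' e = kgeom e - q * kgeom (e - alpha).
Proof.
have [N eN] : exists N, wt w0 e < N%:Z by exists (absz (wt w0 e)).+1; lia.
rewrite (kgeomS eN) (kgeom_sum (wt_alpha eN)) big_distrr /=.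
apply/esym/(canLR (addrK _)); congr (_ + _); apply: eq_bigr => k _.
by rewrite exprS mulrA.
Qed.

Lemma qkernel_kgeom e : qkernel e = kgeom e - kgeom (e - alpha).
Proof.
have [N eN] : exists N, wt w0 e < N%:Z by exists (absz (wt w0 e)).+1; lia.
(* With the bound [N.+1], splitting off k = 0 leaves N terms, as many as in the two expansions of
   [kgeom]. *)
rewrite qkernel_rem (@theta_sum w0 _ _ _ N.+1) ?w0_lr //; last 2 first.
- exact: wpos_lower w0_rem.
- by move: eN; lia.
rewrite (kgeomS eN) (kgeom_sum (wt_alpha eN)) big_nat_recl // mulr0n subr0 mul1r.
rewrite -addrA -sumrB; congr (_ + _); apply: eq_bigr => k _.
by rewrite -mulrBl mulrS opprD addrA.
Qed.

End SimpleRoot.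

End Kernel.

(** * The scalar product as a bilinear form *)

Section LinearExtension.
Variables (n : nat) (K : fieldType).
Local Notation Pol := {mpoly K[n]}.
Implicit Types (f g : Pol) (a b m : 'X_{1..n}).

Section Lext.
Variables (V : lmodType K) (phi : 'X_{1..n} -> V).

Definition lext f : V := \sum_(m <- msupp f) f@_m *: phi m.

Lemma lext_seq f (r : seq 'X_{1..n}) : uniq r -> {subset msupp f <= r} ->
  lext f = \sum_(m <- r) f@_m *: phi m.
Proof.
move=> ur fr; rewrite /lext [RHS](bigID (mem (msupp f))) /= [X in _ + X]big1.
  rewrite addr0 -[RHS]big_filter; apply: perm_big; apply: uniq_perm.
  - exact: msupp_uniq.
  - by rewrite filter_uniq.
  by move=> m; rewrite mem_filter; case: (boolP (m \in msupp f)) => //= /fr ->.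
by move=> m; rewrite mcoeff_msupp negbK => /eqP ->; rewrite scale0r.
Qed.

Lemma lext_linear c f g : lext (c *: f + g) = c *: lext f + lext g.
Proof.
pose r := undup (msupp f ++ msupp g ++ msupp (c *: f + g)).
have ur : uniq r by exact: undup_uniq.
rewrite !(@lext_seq _ r) //; try by move=> m h; rewrite mem_undup !mem_cat h ?orbT.
rewrite scaler_sumr -big_split; apply: eq_bigr => m _ /=.
by rewrite mcoeffD mcoeffZ scalerDl scalerA.
Qed.

Lemma lextX m : lext 'X_[m] = phi m.
Proof. by rewrite /lext msuppX big_seq1 mcoeffX eqxx scale1r. Qed.

Lemma lext0 : lext 0 = 0.
Proof. by rewrite /lext msupp0 big_nil. Qed.

Lemma lextD f g : lext (f + g) = lext f + lext g.
Proof. by have := lext_linear 1 f g; rewrite !scale1r. Qed.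

Lemma lextZ c f : lext (c *: f) = c *: lext f.
Proof. by have := lext_linear c f 0; rewrite lext0 !addr0. Qed.
End Lext.

Definition bilin (F : Pol -> Pol -> K) :=
  (forall c f f' g, F (c *: f + f') g = c * F f g + F f' g) /\
  (forall c f g g', F f (c *: g + g') = c * F f g + F f g').

Lemma bilin0l F g : bilin F -> F 0 g = 0.
Proof.
move=> [h _]; have := h 1 0 0 g; rewrite scaler0 addr0 mul1r => /eqP.
by rewrite -subr_eq0 opprD addrA subrr sub0r oppr_eq0 => /eqP.
Qed.
Lemma bilin0r F f : bilin F -> F f 0 = 0.
Proof.
move=> [_ h]; have := h 1 f 0 0; rewrite scaler0 addr0 mul1r => /eqP.
by rewrite -subr_eq0 opprD addrA subrr sub0r oppr_eq0 => /eqP.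
Qed.

Lemma bilin_ext F G : bilin F -> bilin G ->
  (forall a b, F 'X_[a] 'X_[b] = G 'X_[a] 'X_[b]) -> forall f g, F f g = G f g.
Proof.
move=> bF bG h f g; elim/mpolyind: f => [|c a f _ _ IH]; first by rewrite !bilin0l.
rewrite bF.1 bG.1 IH; congr (_ * _ + _).
elim/mpolyind: g {IH} => [|d b g _ _ IHg]; first by rewrite !bilin0r.
by rewrite bF.2 bG.2 IHg h.
Qed.

(** The opposite of the exponent of x^a (x^b)^club: multiplied by a series A, that monomial has
    constant term [A (cmb a b)]. *)
Definition cmb a b : expo n := [ffun x => (b (rev_ord x))%:Z - (a x)%:Z].

Definition form (A : expo n -> K) f g : K :=
  lext (fun a => lext (fun b => A (cmb a b) : K^o) g : K^o) f.

Lemma form_bilin A : bilin (form A).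
Proof.
split=> [c f f' g|c f g g']; first by rewrite /form lext_linear.
pose F h a : K^o := lext (fun b => A (cmb a b) : K^o) h.
have e a : F (c *: g + g') a = c *: F g a + F g' a by exact: lext_linear.
have fE h : form A f h = \sum_(m <- msupp f) f@_m *: F h m by [].
rewrite !fE big_distrr -big_split /=; apply: eq_bigr => a _.
by rewrite e scalerDr !scalerA [_ * c]mulrC -scalerA.
Qed.

Lemma formX A a b : form A 'X_[a] 'X_[b] = A (cmb a b).
Proof. by rewrite /form !lextX. Qed.

Lemma formDl A f f' g : form A (f + f') g = form A f g + form A f' g.
Proof. by have := (form_bilin A).1 1 f f' g; rewrite scale1r mul1r. Qed.
Lemma formZl A c f g : form A (c *: f) g = c * form A f g.
Proof.
by have := (form_bilin A).1 c f 0 g; rewrite addr0 (bilin0l _ (form_bilin A)) addr0.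
Qed.
Lemma formDr A f g g' : form A f (g + g') = form A f g + form A f g'.
Proof. by have := (form_bilin A).2 1 f g g'; rewrite scale1r mul1r. Qed.
Lemma formZr A c f g : form A f (c *: g) = c * form A f g.
Proof.
by have := (form_bilin A).2 c f g 0; rewrite addr0 (bilin0r _ (form_bilin A)) addr0.
Qed.
Lemma formBl A f f' g : form A (f - f') g = form A f g - form A f' g.
Proof. by rewrite formDl -scaleN1r formZl mulN1r. Qed.
Lemma formBr A f g g' : form A f (g - g') = form A f g - form A f g'.
Proof. by rewrite formDr -scaleN1r formZr mulN1r. Qed.

Lemma form_ext A A' f g : A =1 A' -> form A f g = form A' f g.
Proof.
move=> h; apply: (bilin_ext (form_bilin A) (form_bilin A')) => a b.
by rewrite !formX h.
Qed.

Lemma form_lin A A' c f g :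
  form (fun e => A e - c * A' e) f g = form A f g - c * form A' f g.
Proof.
apply: (@bilin_ext (form (fun e => A e - c * A' e))
  (fun f g => form A f g - c * form A' f g)) => [||a b]; first exact: form_bilin.
  split=> [d f1 f2 g1|d f1 g1 g2].
    by rewrite !formDl !formZl mulrDr opprD mulrCA mulrBr addrACA.
  by rewrite !formDr !formZr mulrDr opprD mulrCA mulrBr addrACA.
by rewrite !formX.
Qed.

Definition eps (x : 'I_n) : expo n := [ffun y => (y == x)%:Z].

Lemma ratio_eps x y : ratio x y = eps x - eps y.
Proof. by apply/ffunP => z; rewrite !ffunE. Qed.

Lemma form_mulXl A x f g : form A ('X_x * f) g = form (fun e => A (e - eps x)) f g.
Proof.
apply: (@bilin_ext (fun f g => form A ('X_x * f) g)) => [||a b].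
- split=> [d f1 f2 g1|d f1 g1 g2]; last by rewrite formDr formZr.
  by rewrite mulrDr -scalerAr formDl formZl.
- exact: form_bilin.
rewrite -mpolyXD !formX; congr A; apply/ffunP => y; rewrite !ffunE mnmDE mnmE eq_sym.
by case: (y == x) => /=; lia.
Qed.

Lemma form_mulXr A x f g :
  form A f ('X_(rev_ord x) * g) = form (fun e => A (e + eps x)) f g.
Proof.
apply: (@bilin_ext (fun f g => form A f ('X_(rev_ord x) * g))) => [||a b].
- split=> [d f1 f2 g1|d f1 g1 g2]; first by rewrite formDl formZl.
  by rewrite mulrDr -scalerAr formDr formZr.
- exact: form_bilin.
rewrite -mpolyXD !formX; congr A; apply/ffunP => y; rewrite !ffunE mnmDE mnmE.
by rewrite (inj_eq rev_ord_inj) eq_sym; case: (y == x) => /=; lia.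
Qed.

Lemma msymXsw i a : msym (stransp i) 'X_[a] = 'X_[sw a i] :> Pol.
Proof.
rewrite msymX; congr 'X_[_]; apply/mnmP => x; rewrite !mnmE.
by rewrite /stransp tpermV.
Qed.

(** [cmb] reads b backwards, so exchanging the entries i and i+1 of the combined exponent exchanges
    those of a and the mirror ones of b. *)
Lemma form_sym A i f g : (forall e, A (eact (stransp i) e) = A e) ->
  form A (msym (stransp i) f) g = form A f (msym (stransp (rev_ord i)) g).
Proof.
move=> hA; apply: (@bilin_ext (fun f g => form A (msym (stransp i) f) g)
  (fun f g => form A f (msym (stransp (rev_ord i)) g))) => [||a b].
- split=> [d f1 f2 g1|d f1 g1 g2]; last by rewrite formDr formZr.
  by rewrite msymD msymZ formDl formZl.
- split=> [d f1 f2 g1|d f1 g1 g2]; first by rewrite formDl formZl.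
  by rewrite msymD msymZ formDr formZr.
rewrite !msymXsw !formX -hA; congr A; apply/ffunP => x; rewrite !ffunE.
rewrite !mactE stranspK; congr (_%:Z - _).
by rewrite stransp_rev.
Qed.

End LinearExtension.

(** * The adjoint of sq_i *)

Section Adjoint.
Variables (n : nat) (K : fieldType) (t : K).
Local Notation Pol := {mpoly K[n]}.
Implicit Types (i j : 'I_n.-1) (f g : Pol).
Variable sq : 'I_n.-1 -> Pol -> Pol.
Hypothesis squareP : forall i f, sq i f * ('X_(lpos i) - 'X_(rpos i)) =
  ('X_(lpos i) - t *: 'X_(rpos i)) * f -
  ('X_(rpos i) - t *: 'X_(lpos i)) * msym (stransp i) f.
Variables (i : 'I_n.-1) (k s p : expo n -> K).
Local Notation alpha := (ratio (lpos i) (rpos i)).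
Hypothesis k_s : forall e, k e = s e - s (e - alpha).
Hypothesis p_s : forall e, p e = s e - t * s (e - alpha).
Hypothesis p_sym : forall e, p (eact (stransp i) e) = p e.

Let s' e := s (e - alpha).

Let form_k f g : form k f g = form s f g - form s' f g.
Proof.
rewrite -[form s' f g]mul1r -form_lin; apply: form_ext => e.
by rewrite mul1r k_s.
Qed.

Let form_p f g : form p f g = form s f g - t * form s' f g.
Proof. by rewrite -form_lin; apply: form_ext => e; rewrite p_s. Qed.

(** Shifts of [s] by one variable: a factor x_(i+1) or x_i on the left turns the form of [R] into
    that of [s] or [s'], and the mirror variables on the right do the same with [R']. *)
Let R e := s (e + eps (rpos i)).
Let R' e := s (e - eps (lpos i)).

Let form_R1 f g : form R ('X_(rpos i) * f) g = form s f g.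
Proof. by rewrite form_mulXl; apply: form_ext => e; rewrite /R subrK. Qed.
Let form_R2 f g : form R ('X_(lpos i) * f) g = form s' f g.
Proof.
rewrite form_mulXl; apply: form_ext => e.
by rewrite /R /s' ratio_eps opprB addrA addrAC.
Qed.
Let form_R'1 f g : form R' f ('X_(rev_ord (lpos i)) * g) = form s f g.
Proof. by rewrite form_mulXr; apply: form_ext => e; rewrite /R' addrK. Qed.
Let form_R'2 f g : form R' f ('X_(rev_ord (rpos i)) * g) = form s' f g.
Proof.
rewrite form_mulXr; apply: form_ext => e.
by rewrite /R' /s' ratio_eps opprB addrA.
Qed.

(** Pairing the defining equation of sq_i f through [R] turns x_i - x_(i+1) into minus the form of
    [k], and gives k(sq_i f, g) = p(f^(s_i), g) + t s(f, g) - s'(f, g). On the right one finds the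
    same expression with g conjugated instead of f, and [p] is invariant. *)
Lemma form_adjoint f g : form k (sq i f) g = form k f (sq (rev_ord i) g).
Proof.
have e1 := congr1 (fun h => form R h g) (squareP i f).
have e2 := congr1 (form R' f) (squareP (rev_ord i) g).
rewrite lpos_rev rpos_rev in e2.
rewrite /= [_ * (_ - _)]mulrC !mulrBl -!scalerAl !formBl !formZl !form_R1 !form_R2 in e1.
rewrite [_ * (_ - _)]mulrC !mulrBl -!scalerAl !formBr !formZr !form_R'1 !form_R'2 in e2.
rewrite !form_k; apply/oppr_inj; rewrite !opprB e1 e2 -!form_p.
by rewrite (form_sym _ _ p_sym).
Qed.

End Adjoint.

(** * The scalar product as the form of its kernel *)

Section ScalarProductForm.
Variable n : nat.

Definition hexp (a : 'X_{1..n}) : expo n := [ffun x => (a x)%:Z].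
Definition cexp (b : 'X_{1..n}) : expo n := [ffun x => - (b (rev_ord x))%:Z].

Lemma hexp_inj : injective hexp.
Proof.
move=> a b /ffunP h; apply/mnmP => x; have := h x; rewrite !ffunE; lia.
Qed.

Lemma foldl_CT0 (A : series n) r : foldl (@CT n) A r 0 = A 0.
Proof. by elim: r A => [|x r IH] A //=; rewrite IH /CT ffunE. Qed.

Lemma spoly_hexp f a : spoly f (hexp a) = f@_a.
Proof.
have -> : spoly f (hexp a) = lext (fun m => (a == m)%:R : Qq^o) f.
  by apply: eq_bigr => m _; rewrite /smon (inj_eq hexp_inj).
have [af|af] := boolP (a \in msupp f).
  rewrite /lext (bigD1_seq a) ?msupp_uniq //= eqxx big1 ?addr0; first exact: mulr1.
  by move=> m /negbTE; rewrite eq_sym => ->; exact: scaler0.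
rewrite /lext big1_seq; last first.
  move=> m /andP[_ mf]; case: eqP => [e|_]; last exact: scaler0.
  by rewrite e mf in af.
by move: af; rewrite mcoeff_msupp negbK => /eqP.
Qed.

Lemma spoly_nhexp f e : (forall a, a \in msupp f -> e != hexp a) -> spoly f e = 0.
Proof.
move=> h; rewrite /spoly big1_seq // => a /andP[_ /h].
by rewrite /smon => /negbTE ->; rewrite mulr0.
Qed.

Lemma smul_spoly f (A : series n) e :
  smul (spoly f) A e = \sum_(a <- msupp f) f@_a * A (e - hexp a).
Proof.
rewrite /smul (@fsumT_seq _ _ [seq hexp a | a <- msupp f]).
- by rewrite big_map; apply: eq_bigr => a _; rewrite spoly_hexp.
- by rewrite map_inj_uniq ?msupp_uniq //; exact: hexp_inj.
move=> d dn; rewrite spoly_nhexp ?mul0r // => a af.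
by apply: contra dn => /eqP ->; exact: map_f.
Qed.

Lemma smul_spoly_sclub f g (A : series n) :
  smul (smul (spoly f) (sclub g)) A 0 =
  \sum_(a <- msupp f) f@_a * \sum_(b <- msupp g) g@_b * A (cmb a b).
Proof.
(* All exponents that can occur in f g^club, so that the Cauchy product with A becomes a sum over a
   list. *)
pose r := undup [seq hexp a + cexp b | a <- msupp f, b <- msupp g].
have ur : uniq r by exact: undup_uniq.
have B d : smul (spoly f) (sclub g) d = \sum_(a <- msupp f) \sum_(b <- msupp g)
    f@_a * (g@_b * (d == hexp a + cexp b)%:R).
  rewrite smul_spoly; apply: eq_bigr => a _; rewrite /sclub big_distrr /=.
  by apply: eq_bigr => b _; rewrite /smon subr_eq addrC.
rewrite [LHS](@fsumT_seq _ _ r) //; last first.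
  move=> d dr; rewrite B big1_seq ?mul0r // => a /andP[_ af].
  rewrite big1_seq // => b /andP[_ bg]; case: eqP => [e|_]; last by rewrite !mulr0.
  have := allpairs_f (fun a b => hexp a + cexp b) af bg.
  by move: dr; rewrite mem_undup e => /negbTE ->.
under eq_bigr do rewrite B big_distrl /=.
rewrite exchange_big /=; apply: eq_big_seq => a af.
under eq_bigr do rewrite big_distrl /=.
rewrite exchange_big /= big_distrr /=; apply: eq_big_seq => b bg.
have mr : hexp a + cexp b \in r.
  by rewrite mem_undup; exact: (allpairs_f (fun a b => hexp a + cexp b)).
have -> : cmb a b = 0 - (hexp a + cexp b).
  by apply/ffunP => x; rewrite !ffunE; lia.
rewrite -(sum_if_eq (fun d => f@_a * (g@_b * A (0 - d))) ur mr).
apply: eq_bigr => d _; case: (d == _); first by rewrite mulr1 mulrA.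
by rewrite !mulr0 mul0r.
Qed.

Lemma qscalarE f g : qscalar f g = form (@qkernel n) f g.
Proof. by rewrite /qscalar foldl_CT0 smul_spoly_sclub. Qed.

End ScalarProductForm.

(** * Triangularity and duality *)

Section Norm.
Variable n : nat.
Implicit Types (i : 'I_n.-1) (u v w : 'X_{1..n}) (e : expo n).

Definition nrm v : nat := (\sum_x v x ^ 2)%N.

Lemma nrm_mact v s : nrm (mact v s) = nrm v.
Proof.
rewrite /nrm [RHS](reindex_inj (@perm_inj _ s)).
by apply: eq_bigr => x _; rewrite mactE.
Qed.
Lemma nrm_sw v i : nrm (sw v i) = nrm v. Proof. exact: nrm_mact. Qed.
Lemma nrm_mrev v : nrm (mrev v) = nrm v.
Proof. by rewrite mrev_mact nrm_mact. Qed.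

Lemma nrm_dom v : nrm (dom v) = nrm v.
Proof. by rewrite -[in RHS](zetaE v) nrm_mact. Qed.

Lemma nrmZ v : (nrm v)%:Z = \sum_x (v x)%:Z ^+ 2.
Proof.
rewrite /nrm -natz natr_sum; apply: eq_bigr => x _.
by rewrite natz -mulnn PoszM expr2.
Qed.

Lemma nrm_split v i : nrm v = (v (lpos i) ^ 2 + (v (rpos i) ^ 2 +
  \sum_(x | (x != lpos i) && (x != rpos i)) v x ^ 2))%N.
Proof.
by rewrite /nrm (bigD1 (lpos i)) //= (bigD1 (rpos i)) //= eq_sym lr_neq.
Qed.

Definition sqnorm e : int := \sum_x e x ^+ 2.

Lemma sqnorm_le0 e : sqnorm e <= 0 -> e = 0.
Proof.
move=> h; have h0 : sqnorm e == 0 by rewrite eq_le h sumr_ge0 // => x _; exact: sqr_ge0.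
apply/ffunP => x; apply/eqP; rewrite ffunE -sqrf_eq0.
by move: h0; rewrite psumr_eq0 => [/allP/(_ x)|y _]; [apply; rewrite mem_index_enum | exact: sqr_ge0].
Qed.

(** Expansion of the square of u + e with e = b omega - u; [nrm_cmb'] is the expansion around b
    omega. *)
Lemma nrm_cmb u b : (nrm b)%:Z = (nrm u)%:Z + wt (fun x => (u x)%:Z) (cmb u b) *+ 2
   + sqnorm (cmb u b).
Proof.
rewrite -(nrm_mrev b) !nrmZ /wt /sqnorm -sumrMnl -!big_split /=.
by apply: eq_bigr => x _; rewrite mrevE ffunE !expr2; lia.
Qed.

Lemma nrm_cmb' u b : (nrm u)%:Z = (nrm b)%:Z +
   wt (fun x => - (mrev b x)%:Z) (cmb u b) *+ 2 + sqnorm (cmb u b).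
Proof.
rewrite -(nrm_mrev b) !nrmZ /wt /sqnorm -sumrMnl -!big_split /=.
by apply: eq_bigr => x _; rewrite mrevE ffunE !expr2; lia.
Qed.

Lemma cmb_eq0 u b : (cmb u b == 0) = (mrev b == u).
Proof.
apply/eqP/eqP => [/ffunP h|<-].
  by apply/mnmP => x; have := h x; rewrite mrevE !ffunE; lia.
by apply/ffunP => x; rewrite !ffunE mrevE subrr.
Qed.

End Norm.

(** The sum of the monomials strictly between x^(d+1) and y^(d+1), which are the lower terms of sq_i
    on a monomial. *)
Lemma telescope_ring (R : comNzRingType) (x y : R) d :
  (\sum_(1 <= k < d.+1) x ^+ (d.+1 - k) * y ^+ k) * (x - y) =
  x ^+ d.+1 * y - x * y ^+ d.+1.
Proof.
elim: d => [|d IH]; first by rewrite big_geq // mul0r !expr1 subrr.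
rewrite big_nat_recr //= subSnn expr1.
have -> : \sum_(1 <= k < d.+1) x ^+ (d.+2 - k) * y ^+ k =
    x * \sum_(1 <= k < d.+1) x ^+ (d.+1 - k) * y ^+ k.
  rewrite big_distrr /=; apply: eq_big_nat => k /andP[_ kd].
  by rewrite subSn ?exprS ?mulrA //; exact: ltnW.
by rewrite mulrDl -mulrA IH !exprS; ring.
Qed.

(** Convexity: bringing two numbers closer at constant sum lowers the sum of their squares, here by
    2ck. *)
Lemma sq_spread (b c k S : nat) : (0 < c)%N -> (0 < k)%N ->
  ((b + c) ^ 2 + ((b + k) ^ 2 + S) < (b + (c + k)) ^ 2 + (b ^ 2 + S))%N.
Proof.
move=> c0 k0; rewrite -!mulnn; have : (0 < c * k)%N by rewrite muln_gt0 c0.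
have : ((b + (c + k)) * (b + (c + k)) + b * b =
  (b + c) * (b + c) + (b + k) * (b + k) + (c * k) * 2)%N by ring.
by lia.
Qed.

Lemma square_mono_ring (R : comNzRingType) (t x y m s : R) d :
  s * (x - y) = x ^+ d * y - x * y ^+ d ->
  (m * x ^+ d + m * y ^+ d + (1 - t) * (m * s)) * (x - y) =
  (x - t * y) * (m * x ^+ d) - (y - t * x) * (m * y ^+ d).
Proof.
move=> e; rewrite mulrDl -!mulrA e; ring.
Qed.

(** * Triangularity of sq_i on monomials *)

Section Support.
Variables (n : nat) (K : fieldType) (t : K).
Local Notation Pol := {mpoly K[n]}.
Implicit Types (i j : 'I_n.-1) (f g : Pol) (u v w : 'X_{1..n}).
Variable sq : 'I_n.-1 -> Pol -> Pol.
Hypothesis squareP : forall i f, sq i f * ('X_(lpos i) - 'X_(rpos i)) =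
  ('X_(lpos i) - t *: 'X_(rpos i)) * f -
  ('X_(rpos i) - t *: 'X_(lpos i)) * msym (stransp i) f.

Definition supp (P : 'X_{1..n} -> Prop) f := forall w, w \in msupp f -> P w.

Lemma suppD P f g : supp P f -> supp P g -> supp P (f + g).
Proof.
by move=> hf hg w /msuppD_le; rewrite mem_cat => /orP[/hf|/hg].
Qed.
Lemma suppZ P c f : supp P f -> supp P (c *: f).
Proof. by move=> hf w /msuppZ_le /hf. Qed.
Lemma suppB P f g : supp P f -> supp P g -> supp P (f - g).
Proof. by move=> hf hg; rewrite -scaleN1r; apply: suppD => //; exact: suppZ. Qed.
Lemma suppX (P : 'X_{1..n} -> Prop) w : P w -> supp P 'X_[w].
Proof. by move=> Pw v; rewrite msuppX inE => /eqP ->. Qed.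
Lemma supp_sum (P : 'X_{1..n} -> Prop) (I : Type) (r : seq I) (Q : pred I) (F : I -> Pol) :
  (forall k, Q k -> supp P (F k)) -> supp P (\sum_(k <- r | Q k) F k).
Proof.
move=> h; elim/big_ind: _ => //; first by move=> w; rewrite msupp0.
exact: suppD.
Qed.
Lemma supp_sub (P Q : 'X_{1..n} -> Prop) f :
  (forall w, P w -> Q w) -> supp P f -> supp Q f.
Proof. by move=> PQ Pf w /Pf/PQ. Qed.

Lemma sq_sum i f : sq i f = \sum_(w <- msupp f) f@_w *: sq i 'X_[w].
Proof.
rewrite {1}[f]mpolyE; elim: (msupp f) => [|w r IH]; first by rewrite !big_nil (square0 squareP).
by rewrite !big_cons (squareD squareP) IH (squareZ squareP).
Qed.

Lemma supp_sq (P Q : 'X_{1..n} -> Prop) i f :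
  (forall w, P w -> supp Q (sq i 'X_[w])) -> supp P f -> supp Q (sq i f).
Proof.
move=> h Pf; rewrite sq_sum big_seq; apply: supp_sum => w /Pf /h.
exact: suppZ.
Qed.

Lemma sq_mono_gt i u : (u (rpos i) < u (lpos i))%N ->
  exists2 g, supp (fun w => (nrm w < nrm u)%N) g &
    sq i 'X_[u] = 'X_[u] + 'X_[sw u i] + g.
Proof.
(* m levels the part at i down to u_(i+1), so that x^u and x^(u s_i) are x^m times the same power of
   x_i and of x_(i+1). *)
move=> h; pose m := [multinom if x == lpos i then u (rpos i) else u x | x < n].
have [d dE] : exists d, (u (lpos i) - u (rpos i))%N = d.+1.
  by exists (u (lpos i) - u (rpos i)).-1; lia.
have rl : (rpos i == lpos i) = false by rewrite eq_sym; apply/negbTE/lr_neq.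
have uE : u = (m + U_(lpos i) *+ d.+1)%MM.
  apply/mnmP => x; rewrite mnmDE mulmnE !mnmE [lpos i == x]eq_sym.
  by case: eqP => [->|] /=; lia.
have sE : sw u i = (m + U_(rpos i) *+ d.+1)%MM.
  apply/mnmP => x; rewrite mactE mnmDE mulmnE !mnmE [rpos i == x]eq_sym /stransp.
  case: tpermP => [->|->|/eqP/negbTE -> /eqP/negbTE ->].
  - by rewrite eqxx [lpos i == _]eq_sym rl /=; lia.
  - by rewrite eqxx rl /=; lia.
  - by rewrite /=; lia.
pose s : Pol := \sum_(1 <= k < d.+1) 'X_(lpos i) ^+ (d.+1 - k) * 'X_(rpos i) ^+ k.
have XuE : 'X_[u] = 'X_[m] * 'X_(lpos i) ^+ d.+1 :> Pol.
  by rewrite [in LHS]uE mpolyXD mpolyXn.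
have XsE : 'X_[sw u i] = 'X_[m] * 'X_(rpos i) ^+ d.+1 :> Pol.
  by rewrite [in LHS]sE mpolyXD mpolyXn.
exists ((1 - t)%:MP * ('X_[m] * s)).
  rewrite mul_mpolyC; apply: suppZ; rewrite /s big_distrr /= big_nat.
  apply: supp_sum => k /andP[k1 kd].
  rewrite !mpolyXn -!mpolyXD; apply: suppX.
  rewrite !(nrm_split _ i) !mnmDE !mulmnE !mnmE !eqxx rl [lpos i == _]eq_sym rl.
  rewrite ?mul1n ?mul0n ?addn0 ?add0n.
  rewrite [X in (_ + (_ + X) < _)%N](_ : _ =
    \sum_(x | (x != lpos i) && (x != rpos i)) u x ^ 2)%N; last first.
    apply: eq_bigr => x /andP[/negbTE h1 /negbTE h2].
    by rewrite !mnmDE !mulmnE !mnmE h1 [lpos i == x]eq_sym h1 [rpos i == x]eq_sym h2 !addn0.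
  have -> : u (lpos i) = (u (rpos i) + ((d.+1 - k) + k))%N by lia.
  by apply: sq_spread; lia.
apply: (square_eq squareP).
rewrite msymXsw XuE XsE -!mul_mpolyC mpolyCB mpolyC1.
apply: square_mono_ring; exact: telescope_ring.
Qed.

Lemma sq_mono_eq i u : u (lpos i) = u (rpos i) -> sq i 'X_[u] = (1 + t) *: 'X_[u].
Proof. by move=> h; apply: (square_sym squareP); rewrite msymXsw sw_id. Qed.

Lemma supp_sq_mono i u :
  supp (fun w => [\/ (nrm w < nrm u)%N, w = u | w = sw u i]) (sq i 'X_[u]).
Proof.
have P1 f : supp (fun w => nrm w < nrm u)%N f ->
    supp (fun w => [\/ (nrm w < nrm u)%N, w = u | w = sw u i]) f.
  by apply: supp_sub => w ?; exact: Or31.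
have Pu : supp (fun w => [\/ (nrm w < nrm u)%N, w = u | w = sw u i]) 'X_[u].
  by apply: suppX; exact: Or32.
have Ps : supp (fun w => [\/ (nrm w < nrm u)%N, w = u | w = sw u i]) 'X_[sw u i].
  by apply: suppX; exact: Or33.
case: (ltngtP (u (rpos i)) (u (lpos i))) => h; last first.
- by rewrite sq_mono_eq //; exact: suppZ.
- have [|g gs e] := @sq_mono_gt i (sw u i); first by rewrite sw_l sw_r.
  rewrite swK in e; rewrite nrm_sw in gs.
  (* Since x^u + x^(u s_i) is symmetric, hence an eigenvector, an ascent of u reduces to the descent
     of u s_i. *)
  have -> : sq i 'X_[u] = sq i ('X_[u] + 'X_[sw u i]) - sq i 'X_[sw u i].
    by rewrite (squareD squareP) addrK.
  apply: suppB; last first.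
    by rewrite e; apply: suppD; [exact: suppD | exact: P1].
  rewrite (square_sym squareP); last by rewrite msymD !msymXsw swK addrC.
  by apply: suppZ; exact: suppD.
have [g gs ->] := sq_mono_gt h.
by apply: suppD; [exact: suppD | exact: P1].
Qed.

Lemma supp_sq_nrm (m : nat) i f :
  supp (fun w => nrm w < m)%N f -> supp (fun w => nrm w < m)%N (sq i f).
Proof.
apply: supp_sq => w wm v /supp_sq_mono[h|->|->] //; first exact: ltn_trans h wm.
by rewrite nrm_sw.
Qed.

(** The exponents allowed in Uhat_v besides v: those of smaller norm, and those of the same orbit
    that are closer to the dominant one. *)
Definition below v w :=
  (nrm w < nrm v)%N \/ dom w = dom v /\ (asc w < asc v)%N.

Lemma asc_sw_gt v i : (v (rpos i) < v (lpos i))%N -> asc (sw v i) = (asc v).+1.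
Proof. by move=> h; have := asc_sw v i; lia. Qed.

Lemma supp_below_sq v i f : (v (rpos i) < v (lpos i))%N ->
  supp (below v) f -> supp (below (sw v i)) (sq i f).
Proof.
move=> h; apply: supp_sq => w bw z /supp_sq_mono zw; rewrite /below nrm_sw dom_sw asc_sw_gt //.
case: bw zw => [bw|[bw1 bw2]] [h'|->|->]; rewrite ?nrm_sw ?dom_sw; try (left; lia).
- by left; move: h'; rewrite -(nrm_dom w) bw1 nrm_dom.
- by right; split=> //; lia.
- by right; split=> //; have := asc_sw w i; lia.
Qed.

End Support.

(** * Families determined by their recursion along orbits *)

Section Main.
Variables (n : nat) (K : fieldType) (t : K).
Local Notation Pol := {mpoly K[n]}.
Implicit Types (i j : 'I_n.-1) (f g : Pol) (u v w z : 'X_{1..n}).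
Variable sq : 'I_n.-1 -> Pol -> Pol.
Hypothesis squareP : forall i f, sq i f * ('X_(lpos i) - 'X_(rpos i)) =
  ('X_(lpos i) - t *: 'X_(rpos i)) * f -
  ('X_(rpos i) - t *: 'X_(lpos i)) * msym (stransp i) f.

Definition orbit_family (c : 'X_{1..n} -> 'I_n.-1 -> K) (b : 'X_{1..n} -> Pol) :=
  [/\ forall v, dominant v -> b v = 'X_[v],
      forall v i, (v (rpos i) < v (lpos i))%N ->
        b (sw v i) = sq i (b v) - c v i *: b v
    & forall v i, v (lpos i) = v (rpos i) -> sq i (b v) = (1 + t) *: b v].

Section Family.
Variables (c : 'X_{1..n} -> 'I_n.-1 -> K) (b : 'X_{1..n} -> Pol).
Hypothesis bF : orbit_family c b.

Lemma family_gt v i : (v (rpos i) < v (lpos i))%N ->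
  sq i (b v) = b (sw v i) + c v i *: b v.
Proof. by case: bF => _ h _ /h ->; rewrite subrK. Qed.

(** Obtained by applying sq_i to the step from v s_i to v, as sq_i^2 = (1 + t) sq_i. *)
Lemma family_lt v i : (v (lpos i) < v (rpos i))%N ->
  sq i (b v) = (1 + t - c (sw v i) i) *: (b v + c (sw v i) i *: b (sw v i)).
Proof.
move=> h; have h' : (sw v i (rpos i) < sw v i (lpos i))%N by rewrite sw_l sw_r.
have e := family_gt h'; rewrite swK in e; rewrite -e.
have -> : b v = sq i (b (sw v i)) - c (sw v i) i *: b (sw v i) by rewrite e addrK.
by rewrite (squareB squareP) (squareZ squareP) (square_quad squareP) scalerBl.
Qed.

Lemma family_sq_lext v i : exists p, sq i (b v) = lext b p.
Proof.
case: (ltngtP (v (rpos i)) (v (lpos i))) => h.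
- exists ('X_[sw v i] + c v i *: 'X_[v]).
  by rewrite family_gt // lextD lextZ !lextX.
- exists ((1 + t - c (sw v i) i) *: ('X_[v] + c (sw v i) i *: 'X_[sw v i])).
  by rewrite family_lt // lextZ lextD lextZ !lextX.
- exists ((1 + t) *: 'X_[v]); rewrite lextZ lextX.
  by case: bF => _ _; apply.
Qed.

Definition spanned f := exists p, f = lext b p.

Lemma spanned_lin d f g : spanned f -> spanned g -> spanned (d *: f + g).
Proof. by move=> [p ->] [r ->]; exists (d *: p + r); rewrite lext_linear. Qed.
Lemma spanned0 : spanned 0. Proof. by exists 0; rewrite lext0. Qed.
Lemma spannedB f g : spanned f -> spanned g -> spanned (f - g).
Proof. by move=> hf hg; rewrite addrC -scaleN1r; exact: spanned_lin. Qed.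

Lemma spanned_sq i f : spanned f -> spanned (sq i f).
Proof.
move=> [p ->]; rewrite /lext; elim: (msupp p) => [|w r IH].
  by rewrite big_nil (square0 squareP); exact: spanned0.
rewrite big_cons (squareD squareP) (squareZ squareP); apply: spanned_lin => //.
exact: family_sq_lext.
Qed.

Lemma spanned_supp (P : 'X_{1..n} -> Prop) f :
  (forall w, P w -> spanned 'X_[w]) -> supp P f -> spanned f.
Proof.
move=> h Pf; rewrite [f]mpolyE big_seq; elim/big_rec: _ => [|w g /Pf/h hw]; first exact: spanned0.
exact: spanned_lin.
Qed.

(** The span of the family is stable under the sq_i, and x^(v s_i) equals sq_i x^v up to x^v and
    terms of smaller norm. Hence an induction on the norm and, inside it, one along the orbit. *)
Lemma spanned_mono w : spanned 'X_[w].
Proof.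
move: {2}(nrm w) (leqnn (nrm w)) => m; elim/ltn_ind: m w => m IH w.
elim/(@orbit_ind n): w => [v dv _|v i vi IHv vm].
  by exists 'X_[v]; rewrite lextX; case: bF => ->.
rewrite nrm_sw in vm; have [g gs e] := sq_mono_gt squareP vi.
have -> : 'X_[sw v i] = sq i 'X_[v] - 'X_[v] - g :> Pol.
  rewrite e; move: 'X_[v] 'X_[sw v i] => x y.
  by rewrite -addrA -opprD [x + y]addrC -[y + x + g]addrA addrK.
have gm : spanned g.
  apply: spanned_supp gs => z zv; apply: (IH (nrm z)) => //.
  exact: leq_trans zv vm.
apply: spannedB => //; apply: spannedB; last exact: IHv.
exact/spanned_sq/IHv.
Qed.

Lemma family_spans f : exists (s : seq 'X_{1..n}) (d : 'X_{1..n} -> K),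
  f = \sum_(v <- s) d v *: b v.
Proof.
have [p ->] : spanned f.
  by apply: (@spanned_supp (fun _ => True)) => // w _; exact: spanned_mono.
by exists (msupp p), (fun v => p@_v).
Qed.

Lemma family_supp_nrm v : supp (fun w => nrm w < (nrm v).+1)%N (b v).
Proof.
case: bF => b1 b2 _; elim/(@orbit_ind n): v => [v dv|v i vi IH].
  by rewrite b1 //; exact: suppX.
rewrite b2 // nrm_sw; apply: suppB; last exact: suppZ.
exact: (supp_sq_nrm squareP).
Qed.

(** In the step from v to v s_i, the leading term x^v produces x^(v s_i); x^v itself also appears
    but is now lower, because [asc] has grown. *)
Lemma family_lead v : exists2 g, supp (below v) g & b v = 'X_[v] + g.
Proof.
case: bF => b1 b2 _; elim/(@orbit_ind n): v => [v dv|v i vi [g gs e]].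
  by exists 0; rewrite ?b1 ?addr0 // => w; rewrite msupp0.
have [h hs e'] := sq_mono_gt squareP vi.
rewrite b2 // e (squareD squareP) e'.
exists ('X_[v] + h + sq i g - c v i *: ('X_[v] + g)); last first.
  by rewrite !addrA [_ + 'X_[sw v i]]addrC.
have bl w : (nrm w < nrm v)%N -> below (sw v i) w by rewrite /below nrm_sw; left.
have bv : supp (below (sw v i)) ('X_[v] : Pol).
  by apply: suppX; right; rewrite dom_sw asc_sw_gt.
apply: suppB; last apply: suppZ; (apply: suppD; [|]).
- by apply: suppD => //; exact: supp_sub hs.
- exact: (supp_below_sq squareP).
- exact: bv.
- apply: supp_sub gs => w [/bl //|[h1 h2]]; right.
  by rewrite dom_sw asc_sw_gt //; split=> //; exact: ltnW.
Qed.

End Family.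

(** * Duality of two families with complementary scalars *)

Section Pairing.
Variable k : expo n -> K.
Hypothesis k_adjoint : forall i f g, form k (sq i f) g = form k f (sq (rev_ord i) g).
Hypothesis k_lower : forall w : 'I_n -> int,
  (forall x y : 'I_n, (x <= y)%N -> w y <= w x) ->
  forall e, wt w e < 0 -> k e = 0.
Hypothesis k0 : k 0 = 1.

Lemma cmb_dominant u w : dominant u -> (nrm w <= nrm u)%N ->
  k (cmb u w) = (mrev w == u)%:R.
Proof.
move=> du wu; have [e|ne] := eqVneq (mrev w) u.
  by have /eqP -> : cmb u w == 0 by rewrite cmb_eq0 e.
apply: contraNeq ne => kn; rewrite -cmb_eq0; apply/eqP/sqnorm_le0.
have : ~~ (wt (fun x => (u x)%:Z) (cmb u w) < 0).
  apply: contra kn => h; apply/eqP; apply: k_lower h => x y xy.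
  by have := du _ _ xy; lia.
by have := nrm_cmb u w; lia.
Qed.

(** Mirror image of [cmb_dominant]: the norm is expanded around w omega, and minus the reversal of a
    dominant w is a weakly decreasing weight. *)
Lemma cmb_antidominant u w : dominant w -> (nrm u < nrm w)%N -> k (cmb u w) = 0.
Proof.
move=> dw uw; apply/eqP; apply: contraTT uw => kn; rewrite -leqNgt.
have : ~~ (wt (fun x => - (mrev w x)%:Z) (cmb u w) < 0).
  apply: contra kn => h; apply/eqP; apply: k_lower h => x y xy.
  by rewrite !mrevE; have := dw (rev_ord y) (rev_ord x); rewrite /=; have := ltn_ord y; lia.
have : 0 <= sqnorm (cmb u w) by apply: sumr_ge0 => x _; exact: sqr_ge0.
by have := nrm_cmb' u w; lia.
Qed.

Lemma form_suppl (P : 'X_{1..n} -> Prop) f g :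
  (forall w, P w -> form k 'X_[w] g = 0) -> supp P f -> form k f g = 0.
Proof.
move=> h Pf; rewrite [f]mpolyE big_seq; elim/big_rec: _ => [|w r /Pf/h hw IH].
  exact: bilin0l (form_bilin k).
by rewrite formDl formZl hw mulr0 add0r.
Qed.

Lemma form_suppr (P : 'X_{1..n} -> Prop) f g :
  (forall w, P w -> form k f 'X_[w] = 0) -> supp P g -> form k f g = 0.
Proof.
move=> h Pg; rewrite [g]mpolyE big_seq; elim/big_rec: _ => [|w r /Pg/h hw IH].
  exact: bilin0r (form_bilin k).
by rewrite formDr formZr hw mulr0 add0r.
Qed.

Variables (c d : 'X_{1..n} -> 'I_n.-1 -> K) (U V : 'X_{1..n} -> Pol).
Hypotheses (UF : orbit_family c U) (VF : orbit_family d V).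
Hypothesis cd : forall v i, (v (rpos i) < v (lpos i))%N ->
  c v i + d (mrev (sw v i)) (rev_ord i) = 1 + t.

(** The steps building V_v move over to f, where sq_i does not raise the bound on the norm; this
    leaves the case of a dominant v. *)
Lemma form_low v f : supp (fun w => nrm w < nrm v)%N f -> form k f (V v) = 0.
Proof.
case: VF => v1 v2 _; elim/(@orbit_ind n): v f => [v dv|v i vi IH] f fs.
  rewrite v1 //; apply: form_suppl fs => w wv; rewrite formX.
  exact: cmb_antidominant.
rewrite nrm_sw in fs; rewrite v2 // formBr formZr IH // mulr0 subr0.
rewrite -{1}[i]rev_ordK -k_adjoint IH //.
exact: (supp_sq_nrm squareP).
Qed.

(** By [cmb_dominant] only x^(v omega) can pair with x^v. Its exponent is antidominant and N(u) <=
    N(v), so it is never below u omega and can only be the leading term of V_(u omega). *)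
Lemma form_dominant u v : dominant v -> (nrm u <= nrm v)%N ->
  form k 'X_[v] (V (mrev u)) = (v == u)%:R.
Proof.
move=> dv uv; have [g gs ->] := family_lead VF (mrev u).
rewrite formDr formX cmb_dominant ?nrm_mrev // mrevK eq_sym.
rewrite (form_suppr _ gs) ?addr0 // => w bw; rewrite formX cmb_dominant //; last first.
  case: bw => [|[e _]]; rewrite ?nrm_mrev; first by move/ltnW/leq_trans; apply.
  by rewrite -nrm_dom e nrm_dom nrm_mrev.
case: eqP => // e; have wE : w = mrev v by rewrite -e mrevK.
case: bw => [|[e1 e2]]; first by rewrite wE !nrm_mrev ltnNge uv.
move: e1 e2; rewrite wE dom_mrev (dom_id dv) => e1.
move=> e2; case: (asc_max (mrev u)) => h; rewrite -e1 in h; last by lia.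
by rewrite -h ltnn in e2.
Qed.

(** The adjoint of sq_i acts on V_(u omega) in one of three ways, according to how u_i compares with
    u_(i+1); the claim for v then applies to u and u s_i, which have the same norm. *)
Lemma form_dual_le v u : (nrm u <= nrm v)%N -> form k (U v) (V (mrev u)) = (v == u)%:R.
Proof.
case: (UF) => u1 u2 _; elim/(@orbit_ind n): v u => [v dv|v i vi IH] u.
  by move=> uv; rewrite u1 // form_dominant.
rewrite nrm_sw => uv; rewrite u2 // formBl formZl k_adjoint (IH u uv).
have IHs : form k (U v) (V (mrev (sw u i))) = (v == sw u i)%:R by rewrite IH ?nrm_sw.
have swE : (sw v i == u) = (v == sw u i) by apply/eqP/eqP => [<-|->]; rewrite swK.
have zl : mrev u (lpos (rev_ord i)) = u (rpos i) by rewrite mrevE lpos_rev rev_ordK.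
have zr : mrev u (rpos (rev_ord i)) = u (lpos i) by rewrite mrevE rpos_rev rev_ordK.
case: (ltngtP (u (lpos i)) (u (rpos i))) => h.
- rewrite (family_gt VF); last by rewrite zl zr.
  rewrite -mrev_sw formDr formZr IHs (IH u uv) swE.
  have -> : (v == u) = false by apply: contraTF vi => /eqP ->; rewrite -leqNgt ltnW.
  by rewrite !mulr0 addr0 subr0.
- rewrite (family_lt VF); last by rewrite zl zr.
  rewrite -mrev_sw formZr formDr formZr IHs (IH u uv) swE.
  have -> : (v == sw u i) = false.
    by apply: contraTF vi => /eqP ->; rewrite sw_l sw_r -leqNgt ltnW.
  rewrite mulr0 addr0; case: eqP => [->|_]; last by rewrite !mulr0 subrr.
  (* Here v = u, and the two diagonal coefficients cancel because the scalars of the two families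
     add up to 1 + t. *)
  by rewrite -(cd h) addrK subrr.
- case: VF => _ _ v3; rewrite v3; last by rewrite zl zr.
  rewrite formZr (IH u uv) swE sw_id //.
  have -> : (v == u) = false by apply: contraTF vi => /eqP ->; rewrite h ltnn.
  by rewrite !mulr0 subrr.
Qed.

Lemma form_dual v u : form k (U v) (V (mrev u)) = (v == u)%:R.
Proof.
case: (leqP (nrm u) (nrm v)) => [|uv]; first exact: form_dual_le.
rewrite form_low; first by case: eqP uv => // ->; rewrite ltnn.
move=> w /(family_supp_nrm UF); rewrite nrm_mrev ltnS => h.
exact: leq_ltn_trans h uv.
Qed.

Lemma form_suml (s : seq 'X_{1..n}) (a : 'X_{1..n} -> K) (b : 'X_{1..n} -> Pol) g :
  form k (\sum_(v <- s) a v *: b v) g = \sum_(v <- s) a v * form k (b v) g.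
Proof.
elim: s => [|v s IH]; first by rewrite !big_nil (bilin0l _ (form_bilin k)).
by rewrite !big_cons formDl formZl IH.
Qed.

Lemma form_sumr (s : seq 'X_{1..n}) (a : 'X_{1..n} -> K) (b : 'X_{1..n} -> Pol) f :
  form k f (\sum_(v <- s) a v *: b v) = \sum_(v <- s) a v * form k f (b v).
Proof.
elim: s => [|v s IH]; first by rewrite !big_nil (bilin0r _ (form_bilin k)).
by rewrite !big_cons formDr formZr IH.
Qed.

Lemma free_U (s : seq 'X_{1..n}) (a : 'X_{1..n} -> K) : uniq s ->
  \sum_(v <- s) a v *: U v = 0 -> forall v, v \in s -> a v = 0.
Proof.
move=> us e v vs; have := form_suml s a U (V (mrev v)).
rewrite e (bilin0l _ (form_bilin k)) (bigD1_seq v) //= form_dual eqxx mulr1.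
rewrite big1 ?addr0 // => w /negbTE wv; by rewrite form_dual wv mulr0.
Qed.

Lemma free_V (s : seq 'X_{1..n}) (a : 'X_{1..n} -> K) : uniq s ->
  \sum_(v <- s) a v *: V v = 0 -> forall v, v \in s -> a v = 0.
Proof.
move=> us e v vs; have := form_sumr s a V (U (mrev v)).
have dual w : form k (U (mrev v)) (V w) = (v == w)%:R.
  by rewrite -[w]mrevK form_dual mrevK (inj_eq (can_inj (@mrevK n))).
rewrite e (bilin0r _ (form_bilin k)) (bigD1_seq v) //= dual eqxx mulr1.
by rewrite big1 ?addr0 // => w wv; rewrite dual eq_sym (negbTE wv) mulr0.
Qed.

End Pairing.
End Main.

(** * The two families on dominant exponents *)

(** The ranks of the elements of A run once through 1, ..., #|A|; the induction removes the element
    of largest rank. *)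
Lemma prod_rank (R : comNzRingType) (T : finType) (A : {set T}) (h : T -> nat)
    (f : nat -> R) : injective h ->
  \prod_(y in A) f #|[set z in A | (h z <= h y)%N]| = \prod_(1 <= r < #|A|.+1) f r.
Proof.
move=> hinj; move: {2}#|A| (erefl #|A|) => m; elim: m A => [|m IH] A Am.
  rewrite Am big_geq // big1 // => y yA.
  by move/eqP: Am; rewrite cards_eq0 => /eqP A0; rewrite A0 inE in yA.
have [x xA] : exists x, x \in A by apply/card_gt0P; rewrite Am.
pose x0 := [arg max_(y > x in A) h y]%N.
have [x0A x0m] : x0 \in A /\ forall y, y \in A -> (h y <= h x0)%N.
  by rewrite /x0; case: arg_maxnP.
have A'm : #|A :\ x0| = m by have := cardsD1 x0 A; rewrite x0A Am; lia.
rewrite (big_setD1 x0) //= Am big_nat_recr //= mulrC; congr (_ * _); last first.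
  congr f; rewrite -Am; apply: eq_card => z; rewrite inE.
  by case: (boolP (z \in A)) => //= /x0m ->.
rewrite -A'm -IH //; apply: eq_bigr => y; rewrite !inE => /andP[yx yA]; congr f.
apply: eq_card => z; rewrite !inE; case: eqP => [->|] //=.
rewrite x0A /= leqNgt; apply/negbF.
by rewrite ltn_neqAle x0m // andbT (inj_eq hinj).
Qed.

Lemma prod_telescope (K : fieldType) (br : nat -> K) m : br 1%N = 1 ->
  (forall r, (0 < r)%N -> br r != 0) ->
  \prod_(1 <= r < m.+1) (br r.+1 / br r) = br m.+1.
Proof.
move=> b1 bn0; elim: m => [|m IH]; first by rewrite big_geq.
by rewrite big_nat_recr //= IH mulrC divfK // bn0.
Qed.

Section Dominant.
Variable n : nat.
Implicit Types (i : 'I_n.-1) (v la : 'X_{1..n}) (s : 'S_n) (x y z : 'I_n).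

Lemma perm_gap s x y : (s y < s x)%N ->
  (s x - s y)%N = #|[set z | (s y <= s z < s x)%N]|.
Proof.
move=> yx; rewrite [in LHS](perm_rank s x) [in LHS](perm_rank s y).
have sub : [set z | (s z < s y)%N] \subset [set z | (s z < s x)%N].
  by apply/subsetP => z; rewrite !inE => /ltn_trans; apply.
have := cardsID [set z | (s z < s y)%N] [set z | (s z < s x)%N].
rewrite (setIidPr sub) => <-; rewrite addKn; apply: eq_card => z.
by rewrite !inE -leqNgt.
Qed.

(** [zeta v] numbers the positions of equal parts consecutively, from right to left. *)
Lemma zeta_gap v x y : (x < y)%N -> v x = v y ->
  (zeta v x - zeta v y)%N = #|[set z | (v z == v x) && (x < z <= y)%N]|.
Proof.
move=> xy e; rewrite perm_gap; last by rewrite zeta_lt /zprec e eqxx xy orbT.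
apply: eq_card => z; rewrite !inE leqNgt !zeta_lt /zprec e.
by apply/idP/idP; lia.
Qed.

Lemma zeta_gap1 v i : v (lpos i) = v (rpos i) ->
  (zeta v (lpos i) - zeta v (rpos i))%N = 1%N.
Proof.
move=> e; rewrite zeta_gap //= (_ : [set z | _] = [set rpos i]) ?cards1 //.
apply/setP => z; rewrite !inE -(inj_eq val_inj) /=; apply/idP/idP; first by lia.
move=> /eqP h; have -> : z = rpos i by exact: val_inj.
by rewrite e eqxx /= !leqnn.
Qed.

Lemma eta_gap1 v i : v (lpos i) = v (rpos i) ->
  (eta v (rpos i) - eta v (lpos i))%N = 1%N.
Proof.
move=> e; rewrite perm_gap; last by rewrite eta_lt /eprec e eqxx /= ltnSn orbT.
rewrite (_ : [set z | _] = [set lpos i]) ?cards1 //.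
apply/setP => z; rewrite !inE leqNgt !eta_lt /eprec -(inj_eq val_inj) /= e.
apply/idP/idP; first by lia.
move=> /eqP h; have -> : z = lpos i by exact: val_inj.
by rewrite e eqxx /=; lia.
Qed.

Lemma eta_dominant la : dominant la -> eta la = 1%g.
Proof.
move=> dl; apply: perm_order_eq => x y; rewrite eta_lt !perm1 /eprec.
case: (ltngtP x y) => [xy|yx|/val_inj ->]; last by rewrite !ltnn andbF.
  by have := dl x y (ltnW xy); lia.
by have := dl y x (ltnW yx); lia.
Qed.

Lemma young_descent la s i : dominant la -> mact la s = la ->
  (s (rpos i) < s (lpos i))%N -> la (lpos i) = la (rpos i).
Proof.
move=> dl sl h; apply/eqP; rewrite eqn_leq (dl (lpos i) (rpos i)) //= andbT.
by rewrite -{1 2}sl !mactE; apply: dl; exact: ltnW.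
Qed.

Lemma young_mul la s i : mact la s = la -> la (lpos i) = la (rpos i) ->
  mact la (stransp i * s)%g = la.
Proof. by move=> sl e; rewrite -mactM sl; exact: sw_id. Qed.

(** For fixed x, the gaps to the equal parts on its right are 1, ..., m, and the quotients telescope
    to br (m+1), where m+1 counts the equal parts from x on. Over the block of parts equal to j,
    these counts run through 1, ..., m_j. *)
Lemma zeta_weight (K : fieldType) (br be : nat -> K) la N : dominant la ->
  (forall x, (la x < N)%N) -> br 1%N = 1 ->
  (forall r, (0 < r)%N -> br r != 0) ->
  (forall r, (0 < r)%N -> be r = br r.+1 / br r) ->
  \prod_(p : 'I_n * 'I_n | (p.1 < p.2)%N)
    (if (zeta la p.2 < zeta la p.1)%N then be (zeta la p.1 - zeta la p.2)%N else 1) =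
  \prod_(0 <= j < N) \prod_(1 <= r < (mult la j).+1) br r.
Proof.
move=> dl lN b1 bn0 bE.
have pz x y : (x < y)%N -> (zeta la y < zeta la x)%N = (la x == la y).
  by move=> xy; rewrite zeta_lt /zprec; have := dl _ _ (ltnW xy); lia.
transitivity (\prod_(x < n) \prod_(y < n | (x < y)%N && (la x == la y))
    be #|[set z | (la z == la x) && (x < z <= y)%N]|).
  rewrite pair_big_dep /= big_mkcond [RHS]big_mkcond /=; apply: eq_bigr => -[x y] _ /=.
  case: (boolP (x < y)%N) => //= xy; rewrite pz //; case: eqP => // e.
  by rewrite zeta_gap.
transitivity (\prod_(x < n) br #|[set y : 'I_n | (la y == la x) && (x <= y)%N]|).
  apply: eq_bigr => x _; pose A := [set y : 'I_n | (x < y)%N && (la x == la y)].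
  rewrite (eq_bigl (mem A)); last by move=> y; rewrite !inE.
  rewrite (eq_bigr (fun y => br #|[set z in A | (z <= y)%N]|.+1 / br #|[set z in A | (z <= y)%N]|)).
    rewrite (prod_rank A (fun r => br r.+1 / br r) val_inj) prod_telescope //.
    congr br; have := cardsD1 x [set y : 'I_n | (la y == la x) && (x <= y)%N].
    rewrite inE eqxx leqnn /= add1n => ->; congr _.+1; apply: eq_card => y.
    by rewrite !inE -(inj_eq val_inj) /=; lia.
  move=> y yA; have : y \in A by [].
  rewrite inE => /andP[xy e].
  have -> : [set z : 'I_n | (la z == la x) && (x < z <= y)%N] = [set z in A | (z <= y)%N].
    by apply/setP => z; rewrite !inE; lia.
  apply: bE; apply/card_gt0P; exists y; by rewrite !inE xy e leqnn.
(* Ranking by n - x counts from the right, as the number of equal parts from x on requires. *)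
have hinj : injective (fun x : 'I_n => (n - x)%N).
  by move=> x y h; apply: val_inj => /=; have := ltn_ord x; have := ltn_ord y; lia.
rewrite big_mkord (partition_big (fun x => Ordinal (lN x)) predT) //=.
apply: eq_bigr => j _; rewrite /mult -(prod_rank _ br hinj).
apply: eq_big => x; first by rewrite inE -(inj_eq val_inj).
move=> /eqP <- /=; congr br; apply: eq_card => z; rewrite !inE.
by have := ltn_ord x; have := ltn_ord z; lia.
Qed.

End Dominant.

(** * Yang-Baxter operators on dominant monomials *)

Section FamilyOnDominant.
Variables (n : nat) (K : fieldType) (t : K).
Local Notation Pol := {mpoly K[n]}.
Implicit Types (i j : 'I_n.-1) (f g : Pol) (v la : 'X_{1..n}) (s : 'S_n).
Variable sq : 'I_n.-1 -> Pol -> Pol.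
Hypothesis squareP : forall i f, sq i f * ('X_(lpos i) - 'X_(rpos i)) =
  ('X_(lpos i) - t *: 'X_(rpos i)) * f -
  ('X_(rpos i) - t *: 'X_(lpos i)) * msym (stransp i) f.
Variables (al : nat -> K) (Z : 'S_n -> Pol -> Pol).
Hypothesis Z1 : forall f, Z 1%g f = f.
Hypothesis ZS : forall s i, (plength s < plength (stransp i * s)%g)%N -> forall f,
  Z (stransp i * s)%g f = sq i (Z s f) - al (s (rpos i) - s (lpos i))%N *: Z s f.

Lemma Z_ascent s i f : (s (lpos i) < s (rpos i))%N ->
  Z (stransp i * s)%g f = sq i (Z s f) - al (s (rpos i) - s (lpos i))%N *: Z s f.
Proof. by move=> h; apply: ZS; rewrite plength_lt. Qed.

Lemma Z_descent s i f : (s (rpos i) < s (lpos i))%N ->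
  Z s f = sq i (Z (stransp i * s)%g f) -
    al (s (lpos i) - s (rpos i))%N *: Z (stransp i * s)%g f.
Proof.
move=> h; rewrite -{1}(stransp_mulK i s) Z_ascent; last by rewrite !permM stranspL stranspR.
by rewrite !permM stranspL stranspR.
Qed.

Lemma plength_desc_lt s i : (s (rpos i) < s (lpos i))%N ->
  (plength (stransp i * s)%g < plength s)%N.
Proof. by have := plength_stransp i s; lia. Qed.

(** Descents from s stay in the stabiliser of lambda, where x^lambda is symmetric in the two
    variables exchanged. Each step multiplies by 1 + t - al(gap), with one gap for each inversion of
    s. *)
Lemma Z_young la s c : dominant la -> mact la s = la ->
  Z s (c *: 'X_[la]) = (c * \prod_(p : 'I_n * 'I_n | (p.1 < p.2)%N)
    (if (s p.2 < s p.1)%N then 1 + t - al (s p.1 - s p.2)%N else 1)) *: 'X_[la].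
Proof.
move=> dl; move: {2}(plength s) (leqnn (plength s)) => m.
elim: m s => [|m IH] s sm sl; have [->|s1] := eqVneq s 1%g.
1,3: rewrite Z1 big1 ?mulr1 // => p; rewrite !perm1; by case: ltngtP.
all: have [i hi] := perm_descent s1; have lt := plength_desc_lt hi.
  by move: sm lt; lia.
have e := young_descent dl sl hi.
rewrite (Z_descent _ hi) IH; [|lia|exact: young_mul].
rewrite (squareZ squareP) (sq_mono_eq squareP e) !scalerA -scalerBl; congr (_ *: _).
have := @big_stransp n K 1 *%R nat
  (fun a b => if (b < a)%N then 1 + t - al (a - b)%N else 1) (fun x => s x) i.
rewrite /= hi ltnNge (ltnW hi) /= mul1r => <-.
rewrite (eq_bigr (fun p : 'I_n * 'I_n => if (s (stransp i p.2) < s (stransp i p.1))%N then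
  1 + t - al (s (stransp i p.1) - s (stransp i p.2))%N else 1)); last first.
  by move=> p _; rewrite !permM.
by move: (\prod_(_ | _) _) => P; ring.
Qed.

(* The Yang-Baxter relations let the path to s be chosen: unless some descent  *)
(* of s exchanges two distinct parts of la, s stabilises la and the path can   *)
(* be taken inside its stabiliser, where the first step kills x^la.            *)
Lemma Z_block_inversion la : dominant la -> al 1%N = 1 + t ->
  forall s (x y : 'I_n), (x < y)%N -> (s y < s x)%N -> la (s x) = la (s y) ->
  Z s 'X_[la] = 0.
Proof.
move=> dl al1 s; move: {2}(plength s) (leqnn (plength s)) => m.
elim: m s => [|m IH] s sm x y xy sxy lxy.
all: have s1 : s != 1%g by apply: contraTneq sxy => ->; rewrite !perm1 -leqNgt ltnW.
  by have [i hi] := perm_descent s1; have := plength_desc_lt hi; move: sm; lia.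
have [/existsP[i /andP[hi ne]]|] := boolP [exists i : 'I_n.-1,
    (s (rpos i) < s (lpos i))%N && (la (s (lpos i)) != la (s (rpos i)))].
  rewrite (Z_descent _ hi) (IH _ _ (stransp i x) (stransp i y)) ?(square0 squareP) ?scaler0 ?subr0 //.
  - by have := plength_desc_lt hi; lia.
  - by apply: stransp_ltn => //; apply: contraNneq ne => -[<- <-]; rewrite lxy.
  - by rewrite !permM !stranspK.
  - by rewrite !permM !stranspK.
rewrite negb_exists => /forallP h.
have sl : mact la s = la.
  rewrite -[RHS](dom_id dl) -(dom_mact la s) dom_id //.
  apply: (@homo_lrpos n geq (fun x => mact la s x) leqnn (@geq_trans)) => i.
  rewrite /geq /= !mactE; case: (ltnP (s (rpos i)) (s (lpos i))) => hi; last exact: dl.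
  by have := h i; rewrite hi /= negbK => /eqP ->.
have [i hi] := perm_descent s1; have e := young_descent dl sl hi.
rewrite (Z_descent _ hi).
have [s'1|s'1] := eqVneq (stransp i * s)%g 1%g.
  have sE : s = stransp i by rewrite -(stransp_mulK i s) s'1 mulg1.
  rewrite s'1 Z1 sE stranspL stranspR /= subSnn al1 (sq_mono_eq squareP e).
  by rewrite subrr.
have [j hj] := perm_descent s'1.
have s'l := young_mul sl e; have e' := young_descent dl s'l hj.
rewrite (IH _ _ (lpos j) (rpos j)) ?(square0 squareP) ?scaler0 ?subr0 //.
- by have := plength_desc_lt hi; lia.
- by rewrite -!mactE s'l.
Qed.

(** For v dominant, dividing by [dc] cancels the eigenvalue of [Z_young]. If v_i = v_(i+1), [zeta v]
    has at i a descent of gap 1; as al 1 = 0 its last step is sq_i itself, whose image consists of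
    eigenvectors. *)
Lemma Z_zeta_family (br : nat -> K) (dc : 'X_{1..n} -> K) : al 1%N = 0 ->
  br 1%N = 1 -> (forall r, (0 < r)%N -> br r != 0) ->
  (forall r, (0 < r)%N -> 1 + t - al r = br r.+1 / br r) ->
  (forall la, dc la = \prod_(0 <= j < (mdeg la).+1) \prod_(1 <= r < (mult la j).+1) br r) ->
  orbit_family t sq (fun v i => al (zeta v (rpos i) - zeta v (lpos i))%N)
    (fun v => Z (zeta v) ((dc (dom v))^-1 *: 'X_[dom v])).
Proof.
move=> al1 b1 bn0 bE dcE; split=> [v dv|v i vi|v i vi].
- rewrite dom_id // Z_young //; last by rewrite -{1}(dom_id dv) zetaE.
  rewrite (@zeta_weight n K br (fun k => 1 + t - al k) v (mdeg v).+1) //.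
    rewrite -dcE mulVf ?scale1r // dcE.
    elim/big_ind: _ => [|a b|j _]; [exact: oner_neq0 | exact: mulf_neq0 |].
    rewrite big_nat; elim/big_ind: _ => [|a b|r /andP[r1 _]].
    - exact: oner_neq0.
    - exact: mulf_neq0.
    - exact: bn0.
  by move=> x; rewrite ltnS mdegE (bigD1 x) //= leq_addr.
- rewrite dom_sw zeta_sw; last by rewrite gtn_eqF.
  by rewrite Z_ascent // zeta_lt /zprec vi.
- have h : (zeta v (rpos i) < zeta v (lpos i))%N by rewrite zeta_lt /zprec vi eqxx /= ltnSn orbT.
  rewrite (Z_descent _ h) zeta_gap1 // al1 scale0r subr0.
  exact: square_quad.
Qed.

(** If v_i = v_(i+1), one more step from [eta v] has gap 1, so it is sq_i - (1 + t), and its result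
    is 0 because it inverts two equal parts. *)
Lemma Z_eta_family : al 1%N = 1 + t ->
  orbit_family t sq (fun v i => al (eta v (rpos i) - eta v (lpos i))%N)
    (fun v => Z (eta v) 'X_[dom v]).
Proof.
move=> al1; split=> [v dv|v i vi|v i vi].
- by rewrite dom_id // eta_dominant // Z1.
- rewrite dom_sw eta_sw; last by rewrite gtn_eqF.
  by rewrite Z_ascent // eta_lt /eprec vi.
- have h : (eta v (lpos i) < eta v (rpos i))%N by rewrite eta_lt /eprec vi eqxx /= ltnSn orbT.
  have := Z_ascent 'X_[dom v] h; rewrite eta_gap1 // al1.
  rewrite (Z_block_inversion (dom_dominant v) al1 (x := lpos i) (y := rpos i)) //.
  + by move/esym/eqP; rewrite subr_eq0 => /eqP.
  + by rewrite !permM stranspL stranspR.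
  + by rewrite !permM stranspL stranspR -!mactE etaE.
Qed.

End FamilyOnDominant.

(** * Verification of the hypotheses for U and Uhat *)

Section Conclusion.
Variable n : nat.

Lemma qint1 : qint 1 = 1.
Proof. by rewrite /qint expr1 divff // q1_neq0. Qed.

Lemma U_family : orbit_family q (@square n)
  (fun v i => aq (zeta v (rpos i) - zeta v (lpos i))) (@U n).
Proof.
apply: (Z_zeta_family (@squareP n) (Y_family n).1 (Y_family n).2 (br := qint)
  (dc := @dcoef n) aq1 qint1 qint_neq0) => [[|r] // _|//].
exact: bqE.
Qed.

Lemma Uhat_family : orbit_family q (@square n)
  (fun v i => bq (eta v (rpos i) - eta v (lpos i))) (@Uhat n).
Proof.
apply: (Z_eta_family (@squareP n) (Yhat_family n).1 (Yhat_family n).2).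
by rewrite /bq aq1 subr0.
Qed.

Lemma eta_gap_rev (v : 'X_{1..n}) i : (v (rpos i) < v (lpos i))%N ->
  (eta (mrev (sw v i)) (rpos (rev_ord i)) - eta (mrev (sw v i)) (lpos (rev_ord i)) =
   zeta v (rpos i) - zeta v (lpos i))%N.
Proof.
move=> h; rewrite lpos_rev rpos_rev (eta_mrev (sw v i) (lpos i)).
rewrite (eta_mrev (sw v i) (rpos i)) zeta_sw; last by rewrite gtn_eqF.
by rewrite !permM stranspL stranspR.
Qed.

Lemma aq_add_bq k : aq k + bq k = 1 + q.
Proof. by rewrite /bq; move: (aq k) (1 + q) => a b; rewrite addrC subrK. Qed.

Lemma aq_bq (v : 'X_{1..n}) i : (v (rpos i) < v (lpos i))%N ->
  aq (zeta v (rpos i) - zeta v (lpos i)) +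
  bq (eta (mrev (sw v i)) (rpos (rev_ord i)) - eta (mrev (sw v i)) (lpos (rev_ord i))) =
  1 + q.
Proof. by move=> h; rewrite (eta_gap_rev h); exact: aq_add_bq. Qed.

Lemma square_adjoint i (f g : {mpoly Qq[n]}) :
  form (@qkernel n) (square i f) g = form (@qkernel n) f (square (rev_ord i) g).
Proof.
exact: (form_adjoint (@squareP n) (@qkernel_kgeom n i) (@kprod'E n i) (@kprod'_sym n i)).
Qed.

End Conclusion.

Theorem theorem2 (n : nat) (n_gt0 : (0 < n)%N) :
  is_basis (@U n) /\ is_basis (@Uhat n) /\
  (forall u v : 'X_{1..n}, qscalar (U v) (Uhat (mrev u)) = (v == u)%:R).
Proof.
have UF := U_family n; have VF := Uhat_family n.
have adj := @square_adjoint n; have cd := @aq_bq n.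
split; [split|split; [split|]].
- exact: (free_U (@squareP n) adj (@qkernel_lower n) (qkernel0 n) UF VF cd).
- exact: (family_spans (@squareP n) UF).
- exact: (free_V (@squareP n) adj (@qkernel_lower n) (qkernel0 n) UF VF cd).
- exact: (family_spans (@squareP n) VF).
move=> u v; rewrite qscalarE.
exact: (form_dual (@squareP n) adj (@qkernel_lower n) (qkernel0 n) UF VF cd).
Qed.
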